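(* Multistage 2-SAT is linear-time solvable if (i) $\tau=1$, (ii) $d=0$, or (iii) $d=n$.
   Context: A 2-CNF formula is a conjunction of clauses, each a disjunction of at most two literals (variables or negated variables). Multistage 2-SAT: the input is a set $X$ of variables, a sequence $\Phi=(\phi_1,\dots,\phi_\tau)$, $\tau\ge 1$, of 2-CNF formulas (the ''stages'') over literals over $X$, and an integer $d\ge 0$. The question is whether there are $\tau$ truth assignments $f_1,\dots,f_\tau\colon X\to\{\bot,\top\}$ such that (i) for each $i\in\{1,\dots,\tau\}$, $f_i$ satisfies $\phi_i$, and (ii) for each $i\in\{1,\dots,\tau-1\}$, $|\{x\in X\mid f_i(x)\ne f_{i+1}(x)\}|\le d$. Here $n=|X|$ is the number of variables. It is a known result that 2-SAT (satisfiability of a single 2-CNF formula) is solvable in linear time. *)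

(* Defs.v *)
From mathcomp Require Import all_boot.

Set Implicit Arguments.
Unset Strict Implicit.
Unset Printing Implicit Defensive.

(* A literal over the variables 0, ..., n-1: (x, true) is x, (x, false) is its
   negation. *)
Definition literal (n : nat) : Type := ('I_n * bool)%type.

(* At most two literals; in particular the empty (unsatisfiable) clause and
   unit clauses are allowed. *)
Definition clause (n : nat) : Type := 2.-bseq (literal n).

Definition cnf2 (n : nat) : Type := seq (clause n).

Definition assignment (n : nat) : Type := {ffun 'I_n -> bool}.

Definition sat_literal n (f : assignment n) (l : literal n) : bool :=
  f l.1 == l.2.

Definition sat_clause n (f : assignment n) (C : clause n) : bool :=
  has (sat_literal f) C.

Definition satisfies n (f : assignment n) (phi : cnf2 n) : bool :=
  all (sat_clause f) phi.

Record instance := Instance {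
  nvars : nat;
  nstages : nat;
  nstages_gt0 : 0 < nstages;
  stages : nstages.-tuple (cnf2 nvars);
  dist : nat
}.

Definition multistage_2sat (I : instance) : Prop :=
  exists f : 'I_(nstages I) -> assignment (nvars I),
    (forall i, satisfies (f i) (tnth (stages I) i)) /\
    (forall i j : 'I_(nstages I), j = i.+1 :> nat ->
       #|[set x | f i x != f j x]| <= dist I).

Definition enc_literal n (l : literal n) : nat := (l.1).*2 + l.2.

Definition enc_clause n (C : clause n) : seq nat :=
  size C :: [seq enc_literal l | l <- C].

Definition enc_cnf2 n (phi : cnf2 n) : seq nat :=
  size phi :: flatten [seq enc_clause C | C <- phi].

(* The set of variables is part of the input and is listed explicitly, so the
   length of the encoding is
   3 + n + \sum_(stages phi) (1 + \sum_(clauses C of phi) (1 + |C|)). *)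
Definition enc_instance (I : instance) : seq nat :=
  (nvars I :: iota 0 (nvars I)) ++
  [:: nstages I; dist I] ++
  flatten [seq enc_cnf2 phi | phi <- stages I].

(* Structured programs over registers r_0, r_1, ... and word arrays
   A_0, A_1, ... .  A program names finitely many registers and arrays, so the
   arrays can be interleaved in a single memory at constant-factor cost. *)
Inductive cmd : Type :=
| Skip
| Const (x k : nat)        (* r_x := k *)
| Add (x y z : nat)        (* r_x := r_y + r_z *)
| Sub (x y z : nat)        (* r_x := r_y - r_z, truncated at 0 *)
| Read (x a y : nat)       (* r_x := A_a[r_y] *)
| Write (a x y : nat)      (* A_a[r_x] := r_y *)
| Seq (p q : cmd)
| If (x : nat) (p q : cmd) (* if r_x != 0 then p else q *)
| While (x : nat) (p : cmd)  (* while r_x != 0 do p *).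

Record state := State { reg : nat -> nat; arr : nat -> nat -> nat }.

Definition set_reg (s : state) (x v : nat) : state :=
  State (fun y => if y == x then v else reg s y) (arr s).

Definition set_arr (s : state) (a i v : nat) : state :=
  State (reg s)
    (fun b j => if (b == a) && (j == i) then v else arr s b j).

(* [exec W p s t s']: started in s, p halts in s' after t unit-cost steps, and
   every word produced on the way is at most W.  Since no rule applies on
   overflow, such a program has no halting run.  Read, Write and Sub cannot
   exceed a bound respected by the current state. *)
Inductive exec (W : nat) : cmd -> state -> nat -> state -> Prop :=
| exec_Skip s : exec W Skip s 1 s
| exec_Const s x k of k <= W :
    exec W (Const x k) s 1 (set_reg s x k)
| exec_Add s x y z of reg s y + reg s z <= W :
    exec W (Add x y z) s 1 (set_reg s x (reg s y + reg s z))
| exec_Sub s x y z :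
    exec W (Sub x y z) s 1 (set_reg s x (reg s y - reg s z))
| exec_Read s x a y :
    exec W (Read x a y) s 1 (set_reg s x (arr s a (reg s y)))
| exec_Write s a x y :
    exec W (Write a x y) s 1 (set_arr s a (reg s x) (reg s y))
| exec_Seq s s1 s2 t1 t2 p q of exec W p s t1 s1 & exec W q s1 t2 s2 :
    exec W (Seq p q) s (t1 + t2) s2
| exec_IfT s s1 t x p q of reg s x != 0 & exec W p s t s1 :
    exec W (If x p q) s t.+1 s1
| exec_IfF s s1 t x p q of reg s x = 0 & exec W q s t s1 :
    exec W (If x p q) s t.+1 s1
| exec_WhileT s s1 s2 t1 t2 x p of reg s x != 0 & exec W p s t1 s1 &
      exec W (While x p) s1 t2 s2 :
    exec W (While x p) s (t1 + t2).+1 s2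
| exec_WhileF s x p of reg s x = 0 :
    exec W (While x p) s 1 s.

(* The input is in A_0 and its length in r_0; everything else is 0. *)
Definition init_state (w : seq nat) : state :=
  State (fun x => if x == 0 then size w else 0)
        (fun a i => if a == 0 then nth 0 w i else 0).

(* The problem Q, restricted to the instances satisfying P, is decided in time
   linear in the length of the encoding, by one program, with words of
   log2 (length + largest input word) + O(1) bits.  The answer is yes iff r_0
   is nonzero at the end. *)
Definition linear_time_solvable (T : Type) (enc : T -> seq nat)
    (P Q : T -> Prop) : Prop :=
  exists (p : cmd) (c : nat), forall I : T, P I ->
    let w := enc I in
    exists (t : nat) (s : state),
      [/\ exec (c * (size w + \max_(k <- w) k)) p (init_state w) t s,
          t <= c * size w
        & reg s 0 != 0 <-> Q I].

(* A run is unique, so existence of a run in [linear_time_solvable] is a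
   statement about the run. *)
Lemma exec_det W p s t1 s1 t2 s2 :
  exec W p s t1 s1 -> exec W p s t2 s2 -> t1 = t2 /\ s1 = s2.
Proof.
move=> H1; elim: H1 t2 s2 => {p s t1 s1};
  try by intros; match goal with H : exec _ _ _ _ _ |- _ => inversion H end.
- move=> s s1 s2 t1 t2 p q _ IH1 _ IH2 t3 s3 H.
  inversion H as [| | | | | |? s1' ? t1' t2' ? ? Hp Hq| | | |]; subst.
  by case: (IH1 _ _ Hp) => ? ?; subst; case: (IH2 _ _ Hq) => -> ->.
- move=> s s1 t x p q nz _ IH t3 s3 H.
  inversion H as [| | | | | | |? ? ? ? ? ? _ Hp|? ? ? ? ? ? z _| |]; subst.
    by case: (IH _ _ Hp) => -> ->.
  by rewrite z in nz.
- move=> s s1 t x p q z _ IH t3 s3 H.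
  inversion H as [| | | | | | |? ? ? ? ? ? nz _|? ? ? ? ? ? _ Hq| |]; subst.
    by rewrite z in nz.
  by case: (IH _ _ Hq) => -> ->.
- move=> s s1 s2 t1 t2 x p nz _ IH1 _ IH2 t3 s3 H.
  inversion H as [| | | | | | | | |? s1' ? t1' t2' ? ? _ Hp Hw|? ? ? z]; subst.
    by case: (IH1 _ _ Hp) => ? ?; subst; case: (IH2 _ _ Hw) => -> ->.
  by rewrite z in nz.
- move=> s x p z t3 s3 H.
  inversion H as [| | | | | | | | |? ? ? ? ? ? ? nz _ _|]; subst => //.
  by rewrite z in nz.
Qed.

(* Main.v *)
Require Import Defs.
From mathcomp Require Import all_boot.
From mathcomp Require Import zify.

Set Implicit Arguments.
Unset Strict Implicit.
Unset Printing Implicit Defensive.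

(** For [d = 0] or [tau = 1] the stages have to be satisfied by a single
    assignment, so their conjunction is a 2-SAT instance; for [d = n] the stages
    are independent 2-SAT instances.

    2-SAT is decided by limited backtracking (Even, Itai and Shamir).  A clause
    [a \/ b] is read as the implications [~a -> b] and [~b -> a].  As long as
    some literal [l] is undecided, the closures of [l] and of [~l] under
    implication are computed in lock step.  The first one to be completed without
    containing a complementary pair is made true: it is closed, and by
    contraposition it agrees with the literals already decided, so it never has
    to be revised.  Its size pays for the work of both threads.  If both closures
    are contradictory, then no assignment exists.

    With many stages there is no time to clear the tables between two stages.
    Every table entry therefore carries a time stamp, the number of an edge or of
    a phase, and entries older than the current stage count as empty. *)

(** * Timed weakest preconditions *)

Fixpoint mod_regs (p : cmd) : seq nat :=
  match p with
  | Const x _ | Add x _ _ | Defs.Sub x _ _ | Read x _ _ => [:: x]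
  | Seq p q | If _ p q => mod_regs p ++ mod_regs q
  | While _ p => mod_regs p
  | _ => [::]
  end.

Fixpoint mod_arrs (p : cmd) : seq nat :=
  match p with
  | Write a _ _ => [:: a]
  | Seq p q | If _ p q => mod_arrs p ++ mod_arrs q
  | While _ p => mod_arrs p
  | _ => [::]
  end.

(** A syntactic over-approximation of the effects of [p]; it carries invariants across a run without
    listing the unchanged fields. *)
Record frame (p : cmd) (s s' : state) : Prop := Frame {
  frame_reg : forall x, x \notin mod_regs p -> reg s' x = reg s x;
  frame_arr : forall a, a \notin mod_arrs p -> arr s' a = arr s a }.

Lemma frame_refl p s : frame p s s.
Proof. by split. Qed.

Lemma frame_trans p s1 s2 s3 : frame p s1 s2 -> frame p s2 s3 -> frame p s1 s3.
Proof.
move=> [r1 a1] [r2 a2]; split=> x hx; first by rewrite r2 // r1.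
by rewrite a2 // a1.
Qed.

Lemma exec_frame W p s t s' : exec W p s t s' -> frame p s s'.
Proof.
elim=> {p s t s'}; try by move=> *; apply: frame_refl.
- by move=> s x k _; split=> // y; rewrite inE /= => /negbTE ->.
- by move=> s x y z _; split=> // u; rewrite inE /= => /negbTE ->.
- by move=> s x y z; split=> // u; rewrite inE /= => /negbTE ->.
- by move=> s x a y; split=> // u; rewrite inE /= => /negbTE ->.
- by move=> s a x y; split=> // b; rewrite inE /= => /negbTE ->.
- move=> s s1 s2 t1 t2 p q _ [r1 a1] _ [r2 a2].
  by split=> x /=; rewrite mem_cat negb_or => /andP[h1 h2]; rewrite ?r2 ?a2 ?r1 ?a1.
- move=> s s1 t x p q _ _ [r1 a1].
  by split=> y /=; rewrite mem_cat negb_or => /andP[h1 h2]; rewrite ?r1 ?a1.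
- move=> s s1 t x p q _ _ [r1 a1].
  by split=> y /=; rewrite mem_cat negb_or => /andP[h1 h2]; rewrite ?r1 ?a1.
- move=> s s1 s2 t1 t2 x p _ _ [r1 a1] _ [r2 a2].
  by split=> y /= h; rewrite ?r2 ?a2 ?r1 ?a1.
Qed.

(** The postcondition also receives the elapsed time, so that results and time bounds are proved
    together. As no rule applies on overflow, a proof also shows that all produced words are at most
    [W]. *)
Definition wp (W : nat) (p : cmd) (s : state) (Q : nat -> state -> Prop) : Prop :=
  exists t s', exec W p s t s' /\ Q t s'.

Section Rules.
Variable W : nat.
Implicit Types (s : state) (Q : nat -> state -> Prop).

(** The consequence rule hands over the frame, so a specification has to mention only what the
    program changes. *)
Lemma wp_weaken p s Q Q' :
  wp W p s Q -> (forall t s', Q t s' -> frame p s s' -> Q' t s') -> wp W p s Q'.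
Proof.
by move=> [t [s' [e q]]] h; exists t, s'; split=> //; apply: h q (exec_frame e).
Qed.

Lemma wp_Skip s Q : Q 1 s -> wp W Skip s Q.
Proof. by move=> q; exists 1, s; split=> //; constructor. Qed.

Lemma wp_Const s x k Q : k <= W -> Q 1 (set_reg s x k) -> wp W (Const x k) s Q.
Proof. by move=> le q; exists 1, (set_reg s x k); split=> //; constructor. Qed.

Lemma wp_Add s x y z Q : reg s y + reg s z <= W ->
  Q 1 (set_reg s x (reg s y + reg s z)) -> wp W (Add x y z) s Q.
Proof. by move=> le q; eexists _, _; split; [constructor|]. Qed.

Lemma wp_Sub s x y z Q :
  Q 1 (set_reg s x (reg s y - reg s z)) -> wp W (Defs.Sub x y z) s Q.
Proof. by move=> q; eexists _, _; split; [constructor|]. Qed.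

Lemma wp_Read s x a y Q :
  Q 1 (set_reg s x (arr s a (reg s y))) -> wp W (Read x a y) s Q.
Proof. by move=> q; eexists _, _; split; [constructor|]. Qed.

Lemma wp_Write s a x y Q :
  Q 1 (set_arr s a (reg s x) (reg s y)) -> wp W (Write a x y) s Q.
Proof. by move=> q; eexists _, _; split; [constructor|]. Qed.

Lemma wp_Seq p q s Q :
  wp W p s (fun t s' => wp W q s' (fun t' => Q (t + t'))) -> wp W (Seq p q) s Q.
Proof.
move=> [t [s1 [e1 [t' [s2 [e2 h]]]]]].
by exists (t + t'), s2; split=> //; econstructor; eauto.
Qed.

Lemma wp_If x p q s Q :
  (reg s x != 0 -> wp W p s (fun t => Q t.+1)) ->
  (reg s x = 0 -> wp W q s (fun t => Q t.+1)) -> wp W (If x p q) s Q.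
Proof.
move=> hp hq; case: (eqVneq (reg s x) 0) => [x0|xn0].
  by have [t [s' [e h]]] := hq x0; exists t.+1, s'; split=> //; constructor.
by have [t [s' [e h]]] := hp xn0; exists t.+1, s'; split=> //; constructor.
Qed.

Lemma wp_While_step x p s Q : reg s x != 0 ->
  wp W p s (fun t s' => wp W (While x p) s' (fun t' => Q (t + t').+1)) ->
  wp W (While x p) s Q.
Proof.
move=> xn0 [t1 [s1 [e1 [t2 [s2 [e2 q]]]]]].
by exists (t1 + t2).+1, s2; split=> //; apply: exec_WhileT e1 e2.
Qed.

Lemma wp_While_stop x p s Q : reg s x = 0 -> Q 1 s -> wp W (While x p) s Q.
Proof. by move=> x0 q; exists 1, s; split=> //; constructor. Qed.

(* The invariant bounds the elapsed time, hence also the number of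
   iterations. *)
Lemma wp_While x p s0 (I : nat -> state -> Prop) B Q :
  I 0 s0 -> (forall t s, I t s -> t <= B) ->
  (forall t s, I t s -> frame p s0 s -> reg s x != 0 ->
     wp W p s (fun t' s' => I (t + t').+1 s')) ->
  (forall t s, I t s -> frame p s0 s -> reg s x = 0 -> Q t.+1 s) ->
  wp W (While x p) s0 Q.
Proof.
move=> I0 IB step stop.
(* Induction on the remaining budget [B - t]: every iteration adds at least one to the time. *)
suff loop m t s : B - t < m -> I t s -> frame p s0 s ->
    wp W (While x p) s (fun t' => Q (t + t')).
  by apply: (loop B.+1 0 s0); [rewrite ltnS leq_subr | | exact: frame_refl].
elim: m t s => // m IH t s lt It fr.
case: (eqVneq (reg s x) 0) => [x0|xn0].
  by exists 1, s; rewrite addn1; split; [constructor | apply: stop].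
have [t1 [s1 [e1 I1]]] := step t s It fr xn0.
have [] := IH _ _ _ I1 (frame_trans fr (exec_frame e1)).
  by have := IB _ _ It; have := IB _ _ I1; lia.
move=> t2 [s2 [e2 q]]; exists (t1 + t2).+1, s2; split.
  by apply: exec_WhileT e1 e2.
by move: q; congr Q; lia.
Qed.

End Rules.

(** * Implication graphs and propagation threads *)

(** The literals of variable [i] have the codes [2 i] and [2 i + 1]; negation flips the last bit. *)
Definition neg (v : nat) : nat := if odd v then v.-1 else v.+1.

Lemma odd_neg v : odd (neg v) = ~~ odd v.
Proof. by rewrite /neg; case: ifP => /=; lia. Qed.

Lemma negK : involutive neg.
Proof. by move=> v; rewrite {1}/neg odd_neg /neg; case: v => //= v; case: odd. Qed.

Lemma neg_neq v : neg v != v.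
Proof. by apply/eqP => /(congr1 odd); rewrite odd_neg; case: odd. Qed.

Lemma neg_lt n v : (neg v < n.*2) = (v < n.*2).
Proof. by rewrite /neg; case: ifP => ?; apply/idP/idP; lia. Qed.

(* An edge (a, b) is the implication from literal a to literal b. *)
Definition models (E : seq (nat * nat)) (f : nat -> bool) : Prop :=
  (forall v, f (neg v) = ~~ f v) /\
  (forall ab, ab \in E -> f ab.1 -> f ab.2).

(** Skew symmetry of an implication graph: closure under contraposition. *)
Definition skew (E : seq (nat * nat)) : Prop :=
  forall a b, (a, b) \in E -> (neg b, neg a) \in E.

Definition upd (f : nat -> nat) (i v : nat) : nat -> nat :=
  fun j => if j == i then v else f j.

(* Edges are numbered from 1, in order of insertion, so that 0 can serve as the
   null pointer. *)
Section Lists.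
Variable E : seq (nat * nat).

Definition src (j : nat) : nat := (nth (0, 0) E j.-1).1.
Definition tgt (j : nat) : nat := (nth (0, 0) E j.-1).2.

(** Adjacency lists are threaded through the edge numbers in descending order: the list of [v]
    begins at [last_out v (size E)], and edge [j] is followed by [last_out (src j) j.-1]. *)
Fixpoint last_out (v k : nat) : nat :=
  if k is k'.+1 then if src k == v then k else last_out v k' else 0.

Lemma last_out_le v k : last_out v k <= k.
Proof. by elim: k => //= k IH; case: ifP => // _; apply: leqW. Qed.

Lemma src_last_out v k : 0 < last_out v k -> src (last_out v k) = v.
Proof. by elim: k => //= k IH; case: ifP => // /eqP. Qed.

Lemma last_out_max v k j : last_out v k < j <= k -> src j != v.
Proof.
elim: k => [|k IH] /=; first by case: j => [|j] /andP[].
case: ifP => [_|/negbT ne] /andP[lt le]; first by lia.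
case: (ltngtP j k.+1) le => // [lt' _|-> //].
by apply: IH; rewrite lt; lia.
Qed.

End Lists.

Lemma src_cat E F j : 0 < j <= size E -> src (E ++ F) j = src E j.
Proof. by case: j => // j /= h; rewrite /src nth_cat h. Qed.

Lemma tgt_cat E F j : 0 < j <= size E -> tgt (E ++ F) j = tgt E j.
Proof. by case: j => // j /= h; rewrite /tgt nth_cat h. Qed.

Lemma last_out_cat E F v k : k <= size E -> last_out (E ++ F) v k = last_out E v k.
Proof.
elim: k => // k IH h /=; rewrite src_cat; last by lia.
by rewrite IH // ltnW.
Qed.

(* A batch consists of the edges numbered above e0. *)
Section Batch.
Variables (E : seq (nat * nat)) (e0 : nat).
Let batch := drop e0 E.
Local Notation src := (src E).
Local Notation tgt := (tgt E).

Definition live (j : nat) : bool := e0 < j <= size E.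
Definition lives : seq nat := iota e0.+1 (size E - e0).
Definition lits : seq nat := map fst batch ++ map snd batch.

Lemma mem_lives j : (j \in lives) = live j.
Proof. by rewrite mem_iota /live; apply/idP/idP; lia. Qed.

Lemma live_batch j : live j -> (src j, tgt j) \in batch.
Proof.
move=> lj; apply/(nthP (0, 0)); exists (j.-1 - e0).
  by rewrite size_drop; move: lj; rewrite /live; move: (size E) => n; lia.
rewrite nth_drop subnKC; last by move: lj; rewrite /live; lia.
by rewrite /src /tgt; case: nth.
Qed.

Lemma batch_live ab : ab \in batch -> exists2 j, live j & ab = (src j, tgt j).
Proof.
move/(nthP (0, 0)) => [i]; rewrite size_drop nth_drop => lt <-.
exists (e0 + i).+1; first by move: lt; rewrite /live; move: (size E) => n; lia.
by rewrite /src /tgt /=; case: nth.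
Qed.

Lemma models_live f j : models batch f -> live j -> f (src j) -> f (tgt j).
Proof. by move=> [_ H] /live_batch /H. Qed.

Lemma tgt_lits j : live j -> tgt j \in lits.
Proof. by move/live_batch => h; rewrite mem_cat (map_f snd h) orbT. Qed.

Lemma size_lits : size lits = (size E - e0).*2.
Proof. by rewrite size_cat !size_map size_drop addnn. Qed.

Hypothesis skewE : skew batch.

Lemma live_contra j : live j ->
  exists2 i, live i & src i = neg (tgt j) /\ tgt i = neg (src j).
Proof. by move/live_batch/skewE/batch_live => [i li [-> ->]]; exists i. Qed.

Lemma neg_lits z : z \in lits -> neg z \in lits.
Proof.
rewrite mem_cat => /orP[] /mapP[[a b] ab ->] /=;
  have h := skewE ab; rewrite mem_cat.
  by rewrite (map_f snd h) orbT.
by rewrite (map_f fst h).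
Qed.

(** A partial assignment, given by its true literals. Being closed under implication, it never has
    to be revised. *)
Record closed_part (D : seq nat) : Prop := ClosedPart {
  cp_uniq : uniq D;
  cp_cons : forall z, z \in D -> neg z \notin D;
  cp_closed : forall j, live j -> src j \in D -> tgt j \in D;
  cp_lits : {subset D <= lits} }.

(** The potential of the amortised analysis: decided literals plus edges leaving them. *)
Definition work (D : seq nat) : nat :=
  size D + count (fun j => src j \in D) lives.

Lemma work_cat q D : work D + size q <= work (q ++ D).
Proof.
rewrite /work size_cat addnAC [size D + _]addnC leq_add2l.
by apply: sub_count => j; rewrite mem_cat orbC => ->.
Qed.

(** Two literals per edge and the edge itself give the factor 3; this makes the total amortised cost
    linear. *)
Lemma work_le D : uniq D -> {subset D <= lits} -> work D <= 3 * (size E - e0).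
Proof.
move=> u s; rewrite mulSn addnC mul2n; apply: leq_add.
  by rewrite -size_lits uniq_leq_size.
by rewrite (leq_trans (count_size _ _)) // size_iota.
Qed.

(** Deciding all targets suffices: by contraposition each source is the negation of a target. The
    remaining variables are set by the parity of the code, which respects negation. *)
Lemma models_of_total D : closed_part D ->
  (forall j, live j -> (tgt j \in D) || (neg (tgt j) \in D)) ->
  exists f, models batch f.
Proof.
move=> cp tot; exists (fun v => (v \in D) || (neg v \notin D) && odd v).
split=> [v|ab /batch_live[j lj ->] /=].
  rewrite negK odd_neg; case: (boolP (v \in D)) => [/(cp_cons cp)/negbTE ->|_] /=.
    by [].
  by case: (neg v \in D) => //=; rewrite ?andbT.
case: (boolP (src j \in D)) => [sD _|nD /=]; first by rewrite (cp_closed cp lj sD).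
have [i li [si ti]] := live_contra lj.
have := tot i li; rewrite ti negK (negbTE nD) orbF => ->.
by [].
Qed.

(* State of one propagation thread: the closure computed so far is the queue q,
   the first h entries of which have been popped; the edge list of the last
   popped one still has to be scanned from edge p on.  M is the time-stamped
   membership table of q, and k counts the elementary steps done. *)
Definition scanned (q : seq nat) (h p j : nat) : bool :=
  (src j \in take h q) && ~~ ((j <= p) && (src j == src p)).

(** A pointer [p <= e0] means the end of a list, since older edges belong to earlier batches.
    [th_reach] turns a conflict into a refutation of the root; [th_steps] charges every step to a
    popped literal or a scanned edge. *)
Record thread (r : nat) (D : seq nat) (ph : nat) (q : seq nat) (h p k : nat)
    (M A : nat -> nat) : Prop := Thread {
  th_uniq : uniq q;
  th_root : r \in q;
  th_le : forall z, M z <= ph;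
  th_mark : forall z, (ph - M z == 0) = (z \in q);
  th_queue : forall i, i < size q -> A i = nth 0 q i;
  th_head : h <= size q;
  th_undec : forall z, z \in q -> (z \notin D) && (neg z \notin D);
  th_cons : forall z, z \in q -> neg z \notin q;
  th_lits : {subset q <= lits};
  th_reach : forall z f, z \in q -> models batch f -> f r -> f z;
  th_ptr_le : p <= size E;
  th_ptr : e0 < p -> src p \in take h q;
  th_closed : forall j, live j -> scanned q h p j -> (tgt j \in q) || (tgt j \in D);
  th_steps : k <= h + count (scanned q h p) lives }.

Variables (r : nat) (D : seq nat) (ph : nat).
Hypothesis cpD : closed_part D.

(** All stamps being older than [ph], the membership table counts as empty without being cleared. *)
Lemma thread_init M A : (forall z, M z < ph) -> A 0 = r -> r \in lits ->
  r \notin D -> neg r \notin D -> thread r D ph [:: r] 0 0 0 (upd M r ph) A.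
Proof.
move=> Mlt A0 rl rD nrD; split=> //.
- by rewrite inE.
- by move=> z; rewrite /upd; case: eqP => // _; apply: ltnW.
- move=> z; rewrite /upd inE; case: (z == r); first by rewrite subnn.
  by have := Mlt z; lia.
- by case.
- by move=> z; rewrite inE => /eqP ->; rewrite rD.
- by move=> z; rewrite !inE => /eqP ->; apply: neg_neq.
- by move=> z; rewrite inE => /eqP ->.
- by move=> z f; rewrite inE => /eqP ->.
Qed.

Variables (q : seq nat) (h p k : nat) (M A : nat -> nat).
Hypothesis th : thread r D ph q h p k M A.

Lemma thread_size : size q <= (size E - e0).*2.
Proof. by rewrite -size_lits uniq_leq_size ?(th_uniq th) //; apply: th_lits th. Qed.

Lemma thread_steps : k <= 3 * (size E - e0).
Proof.
have := th_steps th; have := th_head th; have := thread_size.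
by have := count_size (scanned q h p) lives; rewrite size_iota; lia.
Qed.

(** The new pointer is the last edge of the popped literal, so none of its live edges counts as
    scanned yet: the scanned set is unchanged, and the step is paid for by the increase of [h]. *)
Lemma thread_pop : p <= e0 -> h < size q ->
  thread r D ph q h.+1 (last_out E (nth 0 q h) (size E)) k.+1 M A.
Proof.
move=> pe hq; set x := nth 0 q h; set p' := last_out _ _ _.
have tk : take h.+1 q = rcons (take h q) x by apply: take_nth.
have xt : x \notin take h q.
  have : uniq (take h.+1 q) by rewrite take_uniq ?(th_uniq th).
  by rewrite tk rcons_uniq => /andP[].
have same j : live j -> scanned q h.+1 p' j = scanned q h p j.
  move=> /andP[l1 l2]; rewrite /scanned tk mem_rcons inE.
  have -> : j <= p = false by lia.
  rewrite /= andbT; case: (eqVneq (src j) x) => [e|ne] /=.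
    have jp : j <= p'.
      by rewrite leqNgt; apply/negP => lt; have := @last_out_max E x (size E) j; rewrite lt l2 e eqxx => /(_ isT).
    by rewrite jp e (src_last_out (leq_trans (leq_ltn_trans (leq0n _) l1) jp)) eqxx (negbTE xt).
  case: (posnP p') => [p0|pp]; first by rewrite p0 leqNgt (leq_ltn_trans (leq0n _) l1) andbT.
  by rewrite (src_last_out pp) (negbTE ne) andbF andbT.
case: th => *; split=> //.
- exact: last_out_le.
- by move=> lt; rewrite (src_last_out (leq_ltn_trans (leq0n _) lt)) tk mem_rcons mem_head.
- by move=> j lj; rewrite same //; auto.
- rewrite (@eq_in_count _ _ (scanned q h p)) ?addSn ?ltnS //.
  by move=> j; rewrite mem_lives => /same.
Qed.

Hypothesis pe : e0 < p.
Let p' := last_out E (src p) p.-1.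

Let p_live : live p.
Proof. by rewrite /live pe (th_ptr_le th). Qed.

(** No edge strictly between [p'] and [p] has the source of [p], so advancing the pointer scans
    exactly edge [p]. *)
Let scanned_next j : live j -> scanned q h p' j = scanned q h p j || (j == p).
Proof.
move=> /andP[l1 l2]; rewrite /scanned.
have lp := last_out_le E (src p) p.-1; rewrite -/p' in lp.
case: (eqVneq j p) => [->|ne].
  by rewrite (th_ptr th pe) orbT /=; have -> : p <= p' = false by lia.
rewrite orbF; case: (boolP (src j \in _)) => //= _; congr (~~ _).
case: (eqVneq (src j) (src p)) => [e|ne'].
  rewrite andbT; apply/idP/idP => [|le].
    move=> /andP[h1 h2]; lia.
  have jp : j <= p'.
    rewrite leqNgt; apply/negP => lt.
    by have := @last_out_max E (src p) p.-1 j; rewrite lt e eqxx /= => h'; have := h' ltac:(lia).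
  by rewrite jp e (src_last_out (leq_trans (leq_ltn_trans (leq0n _) l1) jp)) eqxx.
rewrite andbF; apply/negbTE/negP => /andP[le].
by rewrite (src_last_out (leq_trans (leq_ltn_trans (leq0n _) l1) le)) (negbTE ne').
Qed.

Let count_next : count (scanned q h p') lives = (count (scanned q h p) lives).+1.
Proof.
rewrite (@eq_in_count _ _ (predU (scanned q h p) (pred1 p))); last first.
  by move=> j; rewrite mem_lives => /scanned_next.
have := count_predUI (scanned q h p) (pred1 p) lives.
rewrite (@eq_count _ (predI _ _) pred0); last first.
  move=> j /=; case: (eqVneq j p) => [->|_]; last by rewrite andbF.
  by rewrite /scanned leqnn eqxx andbF.
by rewrite count_pred0 addn0 => ->; rewrite count_uniq_mem ?iota_uniq // mem_lives p_live addn1.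
Qed.

Let ptr_next : (p' <= size E) * (e0 < p' -> src p' \in take h q).
Proof.
split; first by have := last_out_le E (src p) p.-1; have := th_ptr_le th; rewrite -/p'; lia.
by move=> lt; rewrite (src_last_out (leq_ltn_trans (leq0n _) lt)) (th_ptr th).
Qed.

Lemma thread_skip : (tgt p \in q) || (tgt p \in D) ->
  thread r D ph q h p' k.+1 M A.
Proof.
move=> tp; have [l1 l2] := ptr_next; have cn := count_next; have sn := scanned_next.
case: th => *; split=> //.
- by move=> j lj; rewrite sn // => /orP[|/eqP -> //]; auto.
- by rewrite cn addnS ltnS.
Qed.

Let source_in : src p \in q.
Proof. exact: mem_take (th_ptr th pe). Qed.

Lemma thread_add : tgt p \notin q -> tgt p \notin D -> neg (tgt p) \notin q ->
  thread r D ph (rcons q (tgt p)) h p' k.+1 (upd M (tgt p) ph) (upd A (size q) (tgt p)).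
Proof.
move=> tq tD ntq; have [l1 l2] := ptr_next; have cn := count_next; have sn := scanned_next.
have tk : take h (rcons q (tgt p)) = take h q.
  by rewrite -cats1 takel_cat // (th_head th).
have sE j : scanned (rcons q (tgt p)) h p' j = scanned q h p' j by rewrite /scanned tk.
(* If the negated target were decided true, the contrapositive edge would put the negated source
   into [D], but the source is undecided. *)
have ntD : neg (tgt p) \notin D.
  apply/negP => inD; have [i li [si ti]] := live_contra p_live.
  have := cp_closed cpD li; rewrite si ti => /(_ inD).
  by have /andP[_ /negbTE ->] := th_undec th source_in.
have lt := tgt_lits p_live.
have reach f : models batch f -> f r -> f (tgt p).
  by move=> mf fr; apply: (models_live mf p_live); apply: (th_reach th source_in mf fr).
case: th => un ro le ma qu he ud co li re pl pt cl st; split.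
- by rewrite rcons_uniq tq.
- by rewrite mem_rcons inE ro orbT.
- by move=> z; rewrite /upd; case: eqP.
- by move=> z; rewrite /upd mem_rcons inE; case: (z == _) => //; rewrite subnn.
- move=> i; rewrite size_rcons ltnS /upd nth_rcons => ile.
  case: eqP => [->|/eqP ne]; first by rewrite ltnn.
  have iq : i < size q by rewrite ltn_neqAle ne.
  by rewrite iq qu.
- by rewrite size_rcons leqW.
- by move=> z; rewrite mem_rcons inE => /orP[/eqP ->|/ud //]; rewrite tD ntD.
- move=> z; rewrite !mem_rcons !inE negb_or => /orP[/eqP ->|zq].
    by rewrite neg_neq ntq.
  rewrite co // andbT; apply/eqP => e; move: ntq; rewrite -e negK.
  by rewrite zq.
- by move=> z; rewrite mem_rcons inE => /orP[/eqP ->|/li].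
- by move=> z f; rewrite mem_rcons inE => /orP[/eqP -> | /re zr]; [apply: reach | apply: zr].
- by [].
- by move=> /l2; rewrite tk.
- move=> j lj; rewrite sE sn // mem_rcons inE => /orP[/(cl j lj)/orP[->|->]|/eqP ->].
  + by rewrite orbT.
  + by rewrite orbT.
  + by rewrite eqxx.
- by rewrite (eq_count sE) cn addnS ltnS.
Qed.

(** The root implies both the target and its negation. *)
Lemma thread_conflict f : neg (tgt p) \in q -> models batch f -> f r = false.
Proof.
move=> nq mf; apply/negP => fr.
have := th_reach th nq mf fr; rewrite mf.1.
by rewrite (models_live mf p_live) // (th_reach th source_in).
Qed.

End Batch.

(** * Completed propagation threads *)

Section Done.
Variables (E : seq (nat * nat)) (e0 : nat) (r : nat) (D : seq nat) (ph : nat).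
Variables (q : seq nat) (h p k : nat) (M A : nat -> nat).
Hypothesis skewE : skew (drop e0 E).
Hypothesis cpD : closed_part E e0 D.
Hypothesis th : thread E e0 r D ph q h p k M A.
Hypotheses (pe : p <= e0) (hq : h = size q).

Let scanned_done j : live E e0 j -> scanned E q h p j = (src E j \in q).
Proof.
rewrite /live /scanned hq take_size => /andP[l1 _].
have -> : j <= p = false by lia.
by rewrite andbT.
Qed.

(** With the queue exhausted, every live edge leaving [q] has been scanned; consistency with [D]
    holds because the queue contains only undecided literals. *)
Lemma thread_done : closed_part E e0 (q ++ D).
Proof.
split.
- rewrite cat_uniq (th_uniq th) (cp_uniq cpD) andbT /=; apply/hasPn => z zD.
  by apply/negP => /(th_undec th) /andP[/negP].
- move=> z; rewrite !mem_cat negb_or => /orP[zq|zD].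
    by have /andP[_ ->] := th_undec th zq; rewrite (th_cons th zq).
  rewrite (cp_cons cpD zD) andbT; apply/negP => /(th_undec th) /andP[_].
  by rewrite negK zD.
- move=> j lj; rewrite !mem_cat => /orP[sq|sD].
    by apply: (th_closed th) => //; rewrite scanned_done.
  by rewrite (cp_closed cpD lj sD) orbT.
- by move=> z; rewrite mem_cat => /orP[/(th_lits th)|/(cp_lits cpD)].
Qed.

(** As [q] and [D] are disjoint, the edges leaving them are counted separately, so the gain in
    potential covers all steps of the thread. *)
Lemma thread_work : work E e0 D + k <= work E e0 (q ++ D).
Proof.
have := th_steps th.
rewrite (@eq_in_count _ (scanned E q h p) (fun j => src E j \in q)); last first.
  by move=> j; rewrite mem_lives => /scanned_done.
rewrite hq /work size_cat.
rewrite (@eq_count _ (fun j => src E j \in q ++ D)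
  (predU (fun j => src E j \in q) (fun j => src E j \in D))); last first.
  by move=> j; rewrite mem_cat.
have := count_predUI (fun j => src E j \in q) (fun j => src E j \in D) (lives E e0).
rewrite (@eq_count _ (predI _ _) pred0); last first.
  move=> j /=; apply/negbTE/negP => /andP[/(th_undec th) /andP[/negP]].
  by [].
rewrite count_pred0 addn0 => ->.
by move: (count (fun j => src E j \in q) _) (count (fun j => src E j \in D) _) => a b; lia.
Qed.

End Done.

(** * The solver *)

(* rE counts the edges and rPh the phases; rE0 and rPh0 are their values at the
   start of the current stage. *)
Notation rRes := 0 (only parsing).
Notation rOne := 1 (only parsing).
Notation rPos := 2 (only parsing).
Notation rCount := 3 (only parsing).
Notation rStages := 4 (only parsing).
Notation rE := 5 (only parsing).
Notation rE0 := 6 (only parsing).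
Notation rPh := 7 (only parsing).
Notation rPh0 := 8 (only parsing).
Notation rBad := 9 (only parsing).
Notation rJ := 10 (only parsing).
Notation rL := 11 (only parsing).
Notation rNL := 12 (only parsing).
Notation rX := 13 (only parsing).
Notation rY := 14 (only parsing).
Notation rZ := 15 (only parsing).
Notation rNZ := 16 (only parsing).
Notation rRun := 17 (only parsing).
Notation rZero := 18 (only parsing).
Notation rCond := 19 (only parsing).
Notation aIn := 0 (only parsing).
Notation aNeg := 1 (only parsing).
Notation aHead := 2 (only parsing).
Notation aNext := 3 (only parsing).
Notation aTgt := 4 (only parsing).
Notation aDec := 5 (only parsing).

Definition rHd (b : bool) : nat := if b then 30 else 20.
Definition rTl (b : bool) : nat := if b then 31 else 21.
Definition rPtr (b : bool) : nat := if b then 32 else 22.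
Definition rConf (b : bool) : nat := if b then 33 else 23.
Definition rDone (b : bool) : nat := if b then 34 else 24.
Definition aMark (b : bool) : nat := if b then 7 else 6.
Definition aQueue (b : bool) : nat := if b then 9 else 8.

Infix ";;" := Seq (at level 62, right associativity).

(** All tests are truncated subtractions: pointer minus [rE0] is nonzero for a live edge, a decision
    stamp minus [rPh0] is nonzero for a literal decided in this batch, and [rPh] minus a mark is
    zero for a literal queued in this phase. *)
Definition thread_step (b : bool) : cmd :=
  Defs.Sub rX (rPtr b) rE0 ;;
  If rX
    (Read rZ aTgt (rPtr b) ;; Read (rPtr b) aNext (rPtr b) ;;
     Read rY aDec rZ ;; Defs.Sub rY rY rPh0 ;;
     If rY Skip
       (Read rY (aMark b) rZ ;; Defs.Sub rY rPh rY ;;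
        If rY
          (Read rNZ aNeg rZ ;; Read rY (aMark b) rNZ ;; Defs.Sub rY rPh rY ;;
           If rY
             (Write (aMark b) rZ rPh ;; Write (aQueue b) (rTl b) rZ ;;
              Add (rTl b) (rTl b) rOne)
             (Const (rConf b) 1))
          Skip))
    (Defs.Sub rX (rTl b) (rHd b) ;;
     If rX
       (Read rX (aQueue b) (rHd b) ;; Add (rHd b) (rHd b) rOne ;;
        Read (rPtr b) aHead rX)
       (Const (rDone b) 1)).

Definition rRoot (b : bool) : nat := if b then rNL else rL.

Definition thread_start (b : bool) : cmd :=
  Write (aMark b) (rRoot b) rPh ;; Write (aQueue b) rZero (rRoot b) ;; Const (rHd b) 0 ;;
  Const (rTl b) 1 ;; Const (rPtr b) 0 ;; Const (rConf b) 0 ;; Const (rDone b) 0.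

Definition thread_commit (b : bool) : cmd :=
  While (rTl b)
    (Defs.Sub (rTl b) (rTl b) rOne ;; Read rZ (aQueue b) (rTl b) ;;
     Write aDec rZ rPh).

Definition race_step : cmd :=
  If (rConf false) Skip (thread_step false) ;;
  If (rConf true) Skip (thread_step true) ;;
  If (rDone false) (Const rRun 0)
    (If (rDone true) (Const rRun 0)
      (If (rConf false) (If (rConf true) (Const rRun 0) Skip) Skip)).

(** After two conflicts, moving [rJ] to the last edge makes the enclosing loop stop. *)
Definition phase : cmd :=
  Add rPh rPh rOne ;; thread_start false ;; thread_start true ;;
  Const rRun 1 ;; While rRun race_step ;;
  If (rDone false) (thread_commit false)
    (If (rDone true) (thread_commit true)
      (Const rBad 1 ;; Add rJ rE rZero)).

(** Only targets of edges serve as roots; by contraposition they cover every variable of the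
    batch. *)
Definition solve_step : cmd :=
  Add rJ rJ rOne ;; Read rL aTgt rJ ;; Read rNL aNeg rL ;;
  Read rX aDec rL ;; Defs.Sub rX rX rPh0 ;;
  Read rY aDec rNL ;; Defs.Sub rY rY rPh0 ;;
  Add rX rX rY ;;
  If rX Skip phase ;;
  Defs.Sub rCond rE rJ.

(** Advancing [rE0] and [rPh0] at the end makes all edges and decisions count as old, which empties
    the batch and the decision table in constant time. *)
Definition solve : cmd :=
  Add rJ rE0 rZero ;; Defs.Sub rCond rE rJ ;;
  While rCond solve_step ;;
  Add rE0 rE rZero ;; Add rPh0 rPh rZero.

Ltac exec1 :=
  lazymatch goal with
  | |- wp _ (Seq _ _) _ _ => apply: wp_Seq
  | |- wp _ Skip _ _ => apply: wp_Skip
  | |- wp _ (Const _ _) _ _ => apply: wp_Const; [try solve [done | lia] |]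
  | |- wp _ (Add _ _ _) _ _ => apply: wp_Add; [rewrite /=; try lia |]
  | |- wp _ (Defs.Sub _ _ _) _ _ => apply: wp_Sub
  | |- wp _ (Read _ _ _) _ _ => apply: wp_Read
  | |- wp _ (Write _ _ _) _ _ => apply: wp_Write
  end; rewrite /=.

(** * Correctness and running time of the solver *)

Section Solve.
Variables (W : nat) (E : seq (nat * nat)) (e0 n : nat).
Hypothesis W_ge : 4 * size E + 10 <= W.
Hypothesis skewE : skew (drop e0 E).
Hypothesis e0_le : e0 <= size E.
Hypothesis lits_lt : forall z, z \in lits E e0 -> z < n.*2.

Record graph_state (s : state) : Prop := GraphState {
  gs_one : reg s rOne = 1;
  gs_zero : reg s rZero = 0;
  gs_e : reg s rE = size E;
  gs_e0 : reg s rE0 = e0;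
  gs_neg : forall v, v < n.*2 -> arr s aNeg v = neg v;
  gs_head : forall v, arr s aHead v = last_out E v (size E);
  gs_next : forall j, 0 < j <= size E -> arr s aNext j = last_out E (src E j) j.-1;
  gs_tgt : forall j, 0 < j <= size E -> arr s aTgt j = tgt E j }.

Definition decided (D : seq nat) (s : state) : Prop :=
  forall z, (arr s aDec z - reg s rPh0 == 0) = (z \notin D).

Definition thread_state (b : bool) (r : nat) (D : seq nat) (k : nat)
    (s : state) (q : seq nat) : Prop :=
  thread E e0 r D (reg s rPh) q (reg s (rHd b)) (reg s (rPtr b)) k
    (arr s (aMark b)) (arr s (aQueue b)) /\ reg s (rTl b) = size q.

(* [k] is the number of steps executed by both threads in lock step; the last
   step of a thread that has terminated did no work. *)
Definition thread_status (b : bool) (r : nat) (D : seq nat) (k : nat)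
    (s : state) : Prop :=
  (forall z, arr s (aMark b) z <= reg s rPh) /\
  if reg s (rConf b) != 0 then
    reg s (rDone b) = 0 /\ forall f, models (drop e0 E) f -> f r = false
  else if reg s (rDone b) != 0 then
    exists q, [/\ thread_state b r D k.-1 s q, reg s (rPtr b) <= e0,
                  reg s (rHd b) = size q & 0 < k]
  else exists q, thread_state b r D k s q.

Lemma thread_step_ok b r D k s : graph_state s -> decided D s ->
  closed_part E e0 D -> thread_status b r D k s ->
  reg s (rConf b) = 0 -> reg s (rDone b) = 0 ->
  wp W (thread_step b) s (fun t s' => t <= 20 /\ thread_status b r D k.+1 s').
Proof.
case=> one zero se se0 sneg shead snext stgt dec cp [Mle].
move=> + c0 d0; rewrite c0 d0 /= => -[q [th tl]].
have qsz := thread_size th.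
move: th; move ep: (reg s (rPtr b)) => p; move eh: (reg s (rHd b)) => h.
move eM: (arr s (aMark b)) Mle => M Mle; move eA: (arr s (aQueue b)) => A.
move eph: (reg s rPh) Mle => ph Mle th.
have hle := th_head th; have ple := th_ptr_le th.
rewrite /thread_step; case: b tl c0 d0 ep eh eM eA => /= tl c0 d0 ep eh eM eA.
all: rewrite /thread_status /thread_state; exec1; exec1.
all: apply: wp_If => /=; rewrite ep se0 => pe; last first.
(* No live edge at the pointer: the thread is done if the queue is exhausted, and otherwise pops the
   next literal. *)
1, 3: do 2 exec1; apply: wp_If => /=; rewrite tl eh => ht; last first.
1, 3: exec1; split=> //; rewrite eM eA eph; split=> //; rewrite c0 /=;
  exists q; rewrite eh ep tl; split=> //; lia.
1, 2: do 4 exec1; rewrite ?eh ?one ?eM ?eA ?eph.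
1, 2: exec1; split=> //; rewrite eM eA eph; split=> //; rewrite c0 d0 /= shead;
  exists q; rewrite tl (th_queue th); [|lia]; split=> //;
  rewrite addn1; apply: thread_pop th _ _; lia.
(* A live edge at the pointer: its target is treated, in this order, as decided, already queued, in
   conflict with the queue, or new. *)
all: have {}pe : e0 < p by lia.
all: have pp : 0 < p <= size E by lia.
all: have lp : live E e0 p by rewrite /live pe.
all: have tz : tgt E p < n.*2 by apply: lits_lt; apply: tgt_lits.
all: have tD := dec (tgt E p).
all: do 8 exec1; rewrite !ep stgt // snext //; apply: wp_If => /=;
  [rewrite tD|move/eqP; rewrite tD] => yd.
1, 3: exec1; split=> //; rewrite eM eA eph; split=> //; rewrite c0 d0 /=;
  exists q; rewrite eh tl; split=> //;
  apply: (thread_skip th pe); move: yd; rewrite negbK => ->; exact: orbT.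
all: do 4 exec1; rewrite eM eph; apply: wp_If => /=;
  [rewrite (th_mark th)|move/eqP; rewrite (th_mark th)] => tq.
2, 4: exec1; split=> //; rewrite eM eA eph; split=> //; rewrite c0 d0 /=;
  exists q; rewrite eh tl; split=> //;
  by apply: (thread_skip th pe); rewrite tq.
all: do 6 exec1; rewrite ?eM ?eph sneg //; apply: wp_If => /=;
  [rewrite (th_mark th)|move/eqP; rewrite (th_mark th)] => ntq.
2, 4: exec1; split=> //; rewrite eM eph; split=> //; rewrite d0;
  by split=> // f; apply: (thread_conflict th pe ntq).
all: do 5 exec1; rewrite tl one.
all: have th' := thread_add skewE cp th pe tq yd ntq.
all: split=> //; rewrite eM eA eph; split; first exact: (th_le th').
all: rewrite c0 d0 /=; exists (rcons q (tgt E p)); rewrite size_rcons addn1 eh.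
all: by split.
Qed.


(** Boolean, so that the side conditions of the frame lemmas are settled by computation. *)
Definition untouched (p : cmd) (xs a : seq nat) : bool :=
  all (fun x => x \notin mod_regs p) xs && all (fun x => x \notin mod_arrs p) a.

Lemma graph_state_frame p s s' :
  frame p s s' -> graph_state s ->
  untouched p [:: rOne; rZero; rE; rE0] [:: aNeg; aHead; aNext; aTgt] ->
  graph_state s'.
Proof.
move=> fr gs /= /andP[/and5P[r1 r2 r3 r4 _] /and5P[a1 a2 a3 a4 _]].
by case: gs => *; split; rewrite ?(frame_reg fr r1) ?(frame_reg fr r2) ?(frame_reg fr r3)
  ?(frame_reg fr r4) ?(frame_arr fr a1) ?(frame_arr fr a2) ?(frame_arr fr a3) ?(frame_arr fr a4).
Qed.

Lemma decided_frame p D s s' : frame p s s' ->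
  decided D s -> untouched p [:: rPh0] [:: aDec] -> decided D s'.
Proof.
move=> fr d /= /andP[/andP[r _] /andP[a _]] z.
by rewrite (frame_reg fr r) (frame_arr fr a).
Qed.

Lemma thread_status_frame p b r D k s s' :
  frame p s s' -> thread_status b r D k s ->
  untouched p [:: rPh; rHd b; rTl b; rPtr b; rConf b; rDone b] [:: aMark b; aQueue b] ->
  thread_status b r D k s'.
Proof.
move=> fr st /= /andP[/and5P[r1 r2 r3 r4 /and3P[r5 r6 _]] /and3P[a1 a2 _]].
move: st.
rewrite /thread_status /thread_state.
by rewrite !(frame_reg fr r1, frame_reg fr r2, frame_reg fr r3, frame_reg fr r4,
  frame_reg fr r5, frame_reg fr r6, frame_arr fr a1, frame_arr fr a2).
Qed.

(** A suspended thread can be given any step count, which lets both threads share one [k]. *)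
Lemma thread_status_conflict b r D k k' s : reg s (rConf b) != 0 ->
  thread_status b r D k s -> thread_status b r D k' s.
Proof. by rewrite /thread_status => ->. Qed.

Lemma thread_race_step_ok b r D k s : graph_state s -> decided D s ->
  closed_part E e0 D -> thread_status b r D k s -> reg s (rDone b) = 0 ->
  wp W (If (rConf b) Skip (thread_step b)) s
    (fun t s' => t <= 21 /\ thread_status b r D k.+1 s').
Proof.
move=> gs dec cp st d0; apply: wp_If => c.
  by apply: wp_Skip; split=> //; apply: thread_status_conflict st.
apply: wp_weaken (thread_step_ok gs dec cp st c d0) _.
by move=> t s' [lt ?] _; split.
Qed.

Definition racing (s : state) : bool :=
  [&& reg s (rDone false) == 0, reg s (rDone true) == 0 &
      (reg s (rConf false) == 0) || (reg s (rConf true) == 0)].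

Lemma status_done_le b r D k s : thread_status b r D k s -> reg s (rDone b) != 0 ->
  reg s (rConf b) = 0.
Proof. by case=> _; case: eqP => //= _ [-> _]. Qed.

Lemma race_step_ok l l' D k s : graph_state s -> decided D s ->
  closed_part E e0 D -> thread_status false l D k s -> thread_status true l' D k s ->
  racing s -> reg s rRun = 1 ->
  wp W race_step s (fun t s' => [/\ t <= 60, thread_status false l D k.+1 s',
    thread_status true l' D k.+1 s' & reg s' rRun = racing s']).
Proof.
move=> gs dec cp st0 st1 /and3P[/eqP d0 /eqP d1 c] run.
apply: wp_Seq; apply: wp_weaken (thread_race_step_ok gs dec cp st0 d0) _.
move=> t1 s1 [lt1 {}st0] fr1.
have {}gs := graph_state_frame fr1 gs isT; have {}dec := decided_frame fr1 dec isT.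
have {}st1 := thread_status_frame fr1 st1 isT.
have {}d1 : reg s1 (rDone true) = 0 by rewrite (frame_reg fr1).
have {}run : reg s1 rRun = 1 by rewrite (frame_reg fr1).
apply: wp_Seq; apply: wp_weaken (thread_race_step_ok gs dec cp st1 d1) _.
move=> t2 s2 [lt2 {}st1] fr2.
have {}gs := graph_state_frame fr2 gs isT; have {}dec := decided_frame fr2 dec isT.
have {}st0 := thread_status_frame fr2 st0 isT.
have {}run : reg s2 rRun = 1 by rewrite (frame_reg fr2).
rewrite /racing; apply: wp_If => [/negbTE h0|/eqP h0].
  by exec1; rewrite ?h0; split=> //; lia.
apply: wp_If => [/negbTE h1|/eqP h1].
  by exec1; rewrite ?h1 ?andbF; split=> //; lia.
apply: wp_If => [/negbTE h2|/eqP h2]; last first.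
  by exec1; rewrite run h0 h1 h2; split=> //; lia.
apply: wp_If => [/negbTE h3|/eqP h3].
  by exec1; rewrite ?h2 ?h3 ?andbF; split=> //; lia.
by exec1; rewrite run h0 h1 h3 orbT; split=> //; lia.
Qed.

(* The thread that is still alive pays for all the steps of the race. *)
Lemma race_ok l l' D s : graph_state s -> decided D s ->
  closed_part E e0 D -> thread_status false l D 0 s -> thread_status true l' D 0 s ->
  racing s -> reg s rRun = 1 ->
  wp W (While rRun race_step) s (fun t s' => exists k,
    [/\ k <= (3 * (size E - e0)).+1, t <= 70 * k + 1, thread_status false l D k s',
        thread_status true l' D k s' & ~~ racing s']).
Proof.
move=> gs dec cp st0 st1 rc run.
(* The extra 1 is for the step that ends the race; before it, [thread_steps] applied to a live
   thread bounds [k]. *)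
pose I t s' := exists k, [/\ k <= (3 * (size E - e0)).+1, t <= 70 * k,
  thread_status false l D k s', thread_status true l' D k s' & reg s' rRun = racing s'].
apply: (@wp_While _ _ _ _ I (70 * (3 * (size E - e0)).+1)).
- by exists 0; split=> //; rewrite rc.
- by move=> t s' [k [h1 h2 _ _ _]]; lia.
- move=> t s' [k [kle tle {}st0 {}st1 rr]] fr rn0.
  have rc' : racing s' by move: rn0; rewrite rr; case: racing.
  have kle' : k <= 3 * (size E - e0).
    have /and3P[/eqP d0 /eqP d1 /orP[/eqP c|/eqP c]] := rc'.
    - by case: st0 => _; rewrite d0 c /= => -[q [/thread_steps]].
    - by case: st1 => _; rewrite d1 c /= => -[q [/thread_steps]].
  have gs' := graph_state_frame fr gs isT; have dec' := decided_frame fr dec isT.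
  apply: wp_weaken (race_step_ok gs' dec' cp st0 st1 rc' _) _; first by rewrite rr rc'.
  move=> t' s'' [lt {}st0 {}st1 rr'] _; exists k.+1; split=> //; lia.
- move=> t s' [k [kle tle {}st0 {}st1 rr]] fr r0; exists k; split=> //; first by lia.
  by move: r0; rewrite rr; case: racing.
Qed.

Lemma thread_commit_ok b q s : reg s rOne = 1 -> reg s (rTl b) = size q ->
  (forall i, i < size q -> arr s (aQueue b) i = nth 0 q i) ->
  wp W (thread_commit b) s (fun t s' => t <= 10 * size q + 1 /\
    forall z, arr s' aDec z = if z \in q then reg s rPh else arr s aDec z).
Proof.
move=> one tl qu.
pose I t s' := exists i, [/\ i <= size q, reg s' (rTl b) = size q - i, t <= 10 * i &
  forall z, arr s' aDec z = if z \in drop (size q - i) q then reg s rPh else arr s aDec z].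
apply: (@wp_While _ _ _ _ I (10 * size q)).
- by exists 0; rewrite subn0 drop_size; split.
- by move=> t s' [i [? _ ? _]]; lia.
- move=> t s' [i [ile tl' tle V]] fr; rewrite tl' => ne.
  have lt : size q - i.+1 < size q by lia.
  have e1 : size q - i = (size q - i.+1).+1 by lia.
  have one' : reg s' rOne = 1 by rewrite (frame_reg fr) ?one //; case: (b).
  have ph' : reg s' rPh = reg s rPh by rewrite (frame_reg fr) //; case: (b).
  have qu' j : j < size q -> arr s' (aQueue b) j = nth 0 q j.
    by rewrite (frame_arr fr); [apply: qu | case: (b)].
  rewrite /I; clear I; case: b {tl qu fr} tl' qu' => /= tl' qu'.
  1, 2: do 5 exec1; rewrite tl' one' qu'; last (by lia).
  1, 2: exists i.+1; split=> //; rewrite /= ?tl'; try lia.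
  1, 2: have e2 : size q - i - 1 = size q - i.+1 by lia.
  1, 2: move=> z; rewrite (drop_nth 0 lt) -e1 inE V e2 ph' /=.
  1, 2: by case: (z == _).
- move=> t s' [i [ile tl' tle V]] fr t0; split=> [|z]; first by lia.
  by rewrite V -tl' t0 drop0.
Qed.

Lemma thread_start_ok b (D : seq nat) s : reg s rZero = 0 -> (forall z, arr s (aMark b) z < reg s rPh) ->
  reg s (rRoot b) \in lits E e0 -> reg s (rRoot b) \notin D -> neg (reg s (rRoot b)) \notin D ->
  wp W (thread_start b) s (fun t s' => [/\ t <= 7, thread_status b (reg s (rRoot b)) D 0 s',
    reg s' (rConf b) = 0 & reg s' (rDone b) = 0]).
Proof.
move=> zero ml rl rD nrD.
have th := @thread_init E e0 _ D (reg s rPh) _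
  (upd (arr s (aQueue b)) 0 (reg s (rRoot b))) ml (erefl _) rl rD nrD.
case: b ml rl rD nrD th => /= ml rl rD nrD th.
all: rewrite /thread_start; do 13 exec1; split=> //; split; first exact: (th_le th).
all: by rewrite /thread_state /= zero; eexists; split; first exact: th.
Qed.

(** Ensures that after [rPh] is incremented all marks are older than the current phase. *)
Definition stamped (s : state) : Prop :=
  [/\ forall z, arr s aDec z <= reg s rPh, forall b z, arr s (aMark b) z <= reg s rPh &
      reg s rPh0 <= reg s rPh].

(** The term [70 * k] is the cost of the race, and committing costs 10 per queued literal. Both
    [k.-1] and [size q] are at most the gain in [work]; the additive 80 absorbs the last step of the
    race and the loop exit. *)
Lemma phase_commit_ok b r D k s : reg s rOne = 1 -> decided D s -> closed_part E e0 D ->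
  (forall z, arr s aDec z <= reg s rPh) -> reg s rPh0 < reg s rPh ->
  thread_status b r D k s -> reg s (rDone b) != 0 ->
  wp W (thread_commit b) s (fun t s' => (forall z, arr s' aDec z <= reg s' rPh) /\
    exists D', [/\ closed_part E e0 D', decided D' s', {subset D <= D'}, r \in D' &
      t + 70 * k + 100 * work E e0 D <= 100 * work E e0 D' + 80]).
Proof.
move=> one dec cp Vle ph0 st d.
have c := status_done_le st d; case: st => _; rewrite c /= d => -[q [[th tl] pe hd k0]].
apply: wp_weaken (thread_commit_ok one tl (th_queue th)) _ => t s' [tle V] fr.
have ph' : reg s' rPh = reg s rPh by rewrite (frame_reg fr) //; case: (b).
have ph0' : reg s' rPh0 = reg s rPh0 by rewrite (frame_reg fr) //; case: (b).
split=> [z|]; first by rewrite V ph'; case: ifP.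
exists (q ++ D); split.
- exact: thread_done cp th pe hd.
- move=> z; rewrite V ph0' mem_cat negb_or; case: ifP => _ /=; last exact: dec.
  by apply/negbTE; lia.
- by move=> z zD; rewrite mem_cat zD orbT.
- by rewrite mem_cat (th_root th).
- move: (thread_work th pe hd) (work_cat E e0 q D) tle k0.
  by move: (size q) (work E e0 D) (work E e0 (q ++ D)) => x y z; lia.
Qed.

(** A successful phase is paid for by the growth of [work], up to a constant. A refutation may take
    time linear in the batch, but it happens at most once because it ends the loop. *)
Lemma phase_ok (D : seq nat) s : graph_state s -> decided D s -> closed_part E e0 D ->
  stamped s -> reg s rPh < W -> reg s rNL = neg (reg s rL) ->
  reg s rL \in lits E e0 -> reg s rL \notin D -> neg (reg s rL) \notin D ->
  wp W phase s (fun t s' => [/\ stamped s', reg s' rPh = (reg s rPh).+1 &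
    (exists D', [/\ closed_part E e0 D' /\ decided D' s', {subset D <= D'},
       (reg s rL \in D') || (neg (reg s rL) \in D'),
       t + 100 * work E e0 D <= 100 * work E e0 D' + 200 &
       reg s' rBad = reg s rBad /\ reg s' rJ = reg s rJ]) \/
    [/\ ~ exists f, models (drop e0 E) f, reg s' rBad = 1, reg s' rJ = size E,
       t <= 100 * (3 * (size E - e0)) + 200 & decided D s']]).
Proof.
move=> gs dec cp [Vle Mle ph0le] phW nl ll lD nlD.
have N : neg (neg (reg s rL)) \notin D by rewrite negK.
rewrite /phase; do 2 exec1; first by rewrite (gs_one gs); lia.
set s1 := set_reg _ _ _.
have gs1 : graph_state s1 by case: gs => *; split.
have ph1 : reg s1 rPh = (reg s rPh).+1 by rewrite /s1 /= (gs_one gs) addn1.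
have M1 b z : arr s1 (aMark b) z < reg s1 rPh by rewrite ph1 ltnS Mle.
exec1; apply: wp_weaken (@thread_start_ok false D s1 (gs_zero gs1) (M1 false) ll lD nlD) _.
move=> t2 s2 [lt2 st0 c0 d0] fr2.
have gs2 := graph_state_frame fr2 gs1 isT.
have M2 z : arr s2 (aMark true) z < reg s2 rPh by rewrite (frame_arr fr2) // (frame_reg fr2).
have nl2 : reg s2 (rRoot true) = neg (reg s rL) by rewrite (frame_reg fr2).
exec1; apply: wp_weaken (@thread_start_ok true D s2 (gs_zero gs2) M2 _ _ _) _; rewrite ?nl2 ?neg_lits //.
move=> t3 s3 [lt3 st1 c1 d1] fr3.
have gs3 := graph_state_frame fr3 gs2 isT.
have {}st0 := thread_status_frame fr3 st0 isT.
have dec3 : decided D s3.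
  by apply: decided_frame fr3 _ isT; apply: decided_frame fr2 _ isT.
do 2 exec1.
set s4 := set_reg s3 17 1.
have gs4 : graph_state s4 by case: gs3 => *; split.
have rc4 : racing s4 by rewrite /racing /= d1 c1 -[23]/(rConf false) -[24]/(rDone false) !(frame_reg fr3) // c0 d0.
exec1; apply: wp_weaken (race_ok gs4 dec3 cp st0 st1 rc4 erefl) _.
move=> t5 s5 [k [kle tle {}st0 {}st1 rc5]] fr5.
have ph5 : reg s5 rPh = (reg s rPh).+1.
  by rewrite (frame_reg fr5) //= (frame_reg fr3) // (frame_reg fr2) // ph1.
have ph05 : reg s5 rPh0 = reg s rPh0.
  by rewrite (frame_reg fr5) //= (frame_reg fr3) // (frame_reg fr2).
have bad5 : reg s5 rBad = reg s rBad.
  by rewrite (frame_reg fr5) //= (frame_reg fr3) // (frame_reg fr2).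
have j5 : reg s5 rJ = reg s rJ.
  by rewrite (frame_reg fr5) //= (frame_reg fr3) // (frame_reg fr2).
have V5 z : arr s5 aDec z <= reg s5 rPh.
  by rewrite ph5 (frame_arr fr5) //= (frame_arr fr3) // (frame_arr fr2) //; apply: leqW (Vle z).
have gs5 := graph_state_frame fr5 gs4 isT.
have dec5 : decided D s5 by apply: decided_frame fr5 _ isT.
have M5 b z : arr s5 (aMark b) z <= reg s5 rPh.
  by case: b; [case: st1 | case: st0].
have lt5 : reg s5 rPh0 < reg s5 rPh by rewrite ph5 ph05.
apply: wp_If => [d0'|/eqP d0'].
  apply: wp_weaken (phase_commit_ok (gs_one gs5) dec5 cp V5 lt5 st0 d0') _.
  move=> t6 s6 [V6 [D' [cp' dec' sub rD' le']]] fr6.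
  split; [split=> // | by rewrite (frame_reg fr6) | left].
  - by move=> b z; rewrite (frame_reg fr6) // (frame_arr fr6) //; case: b.
  - by rewrite !(frame_reg fr6) // ltnW.
  exists D'; split=> //; [by rewrite rD' | by lia | by rewrite !(frame_reg fr6)].
apply: wp_If => [d1'|/eqP d1'].
  apply: wp_weaken (phase_commit_ok (gs_one gs5) dec5 cp V5 lt5 st1 d1') _.
  move=> t6 s6 [V6 [D' [cp' dec' sub rD' le']]] fr6.
  split; [split=> // | by rewrite (frame_reg fr6) | left].
  - by move=> b z; rewrite (frame_reg fr6) // (frame_arr fr6) //; case: b.
  - by rewrite !(frame_reg fr6) // ltnW.
  exists D'; split=> //; [by rewrite rD' orbT | by lia | by rewrite !(frame_reg fr6)].
(* The race ended with no thread done, so both are in conflict: a model would have to falsify the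
   literal and its negation. *)
move: rc5; rewrite /racing d0' d1' /= negb_or => /andP[c0' c1'].
do 3 exec1; try lia.
  by rewrite (gs_e gs5) (gs_zero gs5); lia.
split=> //; first by split=> //; apply: ltnW.
right; split=> //.
- move=> [f mf]; move: st0 st1; rewrite /thread_status /= c0' c1'.
  case=> _ [_ /(_ f mf) f1] [_ [_ /(_ f mf)]].
  by rewrite mf.1 f1.
- by rewrite (gs_e gs5) (gs_zero gs5) addn0.
- by lia.
Qed.

(** Each visited edge contributes 300 for the constant costs, and the potential pays for the races.
    As [work] is at most three times the number of edges, 900 per edge leaves room for one refuting
    phase. [reg s rPh <= reg s rJ] keeps the stamps within the word bound. *)
Definition solve_inv (s0 : state) (t : nat) (s : state) : Prop :=
  [/\ e0 <= reg s rJ <= size E, stamped s, reg s rPh <= reg s rJ,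
      reg s rCond = size E - reg s rJ &
      (exists D, [/\ closed_part E e0 D, decided D s,
         forall i, e0 < i <= reg s rJ -> (tgt E i \in D) || (neg (tgt E i) \in D),
         t <= 300 * (reg s rJ - e0) + 100 * work E e0 D & reg s rBad = reg s0 rBad]) \/
      [/\ ~ exists f, models (drop e0 E) f, reg s rJ = size E, reg s rBad = 1 &
         t <= 900 * (size E - e0)]].

Lemma solve_step_ok s0 t s : graph_state s -> solve_inv s0 t s -> reg s rCond != 0 ->
  wp W solve_step s (fun t' s' => solve_inv s0 (t + t').+1 s').
Proof.
move=> gs [jle [Vle Mle ph0le] phj cond inv]; rewrite cond => ne.
case: inv => [[D [cp dec tot tle bad]]|[_ jE]]; last by rewrite jE subnn in ne.
have {}ne : reg s rJ < size E by lia.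
have [one zero se se0 sneg _ _ stgt] := gs.
have wD := work_le (cp_uniq cp) (@cp_lits _ _ _ cp).
set j1 := (reg s rJ).+1; set z := tgt E j1.
have lj : live E e0 j1 by rewrite /live /j1; lia.
have zl : z \in lits E e0 by apply: tgt_lits.
rewrite /solve_step; do 16 exec1; rewrite one addn1 stgt ?sneg ?lits_lt //; try lia.
  by have := Vle z; have := Vle (neg z); rewrite -/j1 -/z; lia.
set s1 := set_reg _ _ _.
have gs1 : graph_state s1 by case: gs => *; split.
have st1 : stamped s1 by split.
have Jz : reg s1 rL = z by [].
exec1; apply: wp_If => /= x0.
  apply: wp_Skip; exec1; rewrite se; split=> /=; try lia; try by [].
  left; exists D; split=> //; last by lia.
  move=> i /andP[i1]; rewrite leq_eqVlt => /orP[/eqP ->|i2]; last by apply: tot; lia.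
  rewrite -[_ \in D]negbK -[neg _ \in D]negbK -negb_and -!dec -/j1 -/z.
  by apply/negP => /andP[/eqP a /eqP b]; rewrite a b in x0.
rewrite -/j1 -/z in x0.
have zD : z \notin D by rewrite -dec; lia.
have nzD : neg z \notin D by rewrite -dec; lia.
have phW : reg s1 rPh < W by rewrite /=; lia.
apply: wp_weaken (phase_ok gs1 dec cp st1 phW erefl zl zD nzD) _.
move=> t2 s2 [st2 ph2 out] fr2.
have e2 : reg s2 rE = size E by rewrite (frame_reg fr2).
have ph02 : reg s2 rPh0 = reg s rPh0 by rewrite (frame_reg fr2).
exec1; rewrite e2.
case: out => [[D' [[cp' dec'] sub zD' tle' [bad2 j2]]]|[nm bad2 j2 tle' dec']].
  rewrite /= -/j1 in j2; rewrite /= in bad2 ph2; rewrite Jz in zD'.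
  split; rewrite /= ?j2; try by []; try lia.
  left; exists D'; split=> //; try lia.
  move=> i /andP[i1]; rewrite leq_eqVlt => /orP[/eqP ->|i2]; first exact: zD'.
  have /tot/orP[] : e0 < i <= reg s rJ by lia.
    by move/sub=> ->.
  by move/sub=> ->; rewrite orbT.
rewrite /= in ph2; split; rewrite /= ?j2; try by []; try lia.
by right; split=> //; lia.
Qed.

Lemma solve_ok s : graph_state s -> stamped s -> reg s rPh0 = reg s rPh -> reg s rPh <= e0 ->
  wp W solve s (fun t s' => [/\ t <= 900 * (size E - e0) + 10, stamped s',
    reg s' rPh0 = reg s' rPh /\ reg s' rPh <= size E, reg s' rE0 = size E &
    (exists f, models (drop e0 E) f) /\ reg s' rBad = reg s rBad \/
    ~ (exists f, models (drop e0 E) f) /\ reg s' rBad = 1]).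
Proof.
move=> gs st eph phe; have [one zero se se0 _ _ _ _] := gs.
rewrite /solve; do 4 exec1; rewrite se0 zero addn0 se.
set s1 := set_reg _ _ _.
have gs1 : graph_state s1 by case: gs => *; split.
exec1; apply: (@wp_While _ _ _ _ (solve_inv s) (900 * (size E - e0))).
(* Nothing is decided at the start, since no stamp exceeds [rPh], which equals [rPh0]. *)
- split=> //=; try lia; left; exists [::]; split=> //; try lia.
  move=> z /=; case: st => V _ _; rewrite eph; apply/eqP; have := V z; lia.
- move=> t s' [? _ _ _ [[D [cp _ _ le _]]|[_ _ _ //]]].
  have := work_le (cp_uniq cp) (@cp_lits _ _ _ cp); lia.
- move=> t s' inv fr ne; apply: solve_step_ok inv ne.
  exact: graph_state_frame fr gs1 isT.
move=> t s' [jle [V M ph0le] phj cond inv] fr c0.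
have [one' zero' se' _ _ _ _ _] := graph_state_frame fr gs1 isT.
do 3 exec1; rewrite zero' se' ?addn0; try lia.
have jE : reg s' rJ = size E by lia.
have tle : t <= 900 * (size E - e0).
  case: inv => [[D [cp _ _ le _]]|[_ _ _ //]].
  have := work_le (cp_uniq cp) (@cp_lits _ _ _ cp); lia.
split; [lia | by split | by split=> //; rewrite -jE | by [] | ].
case: inv => [[D [cp _ tot _ bad]]|[nm _ bad _]]; [left|right]; split=> //.
by apply: (models_of_total skewE cp) => j lj; apply: tot; rewrite jE.
Qed.

End Solve.

(** * Reading the input *)

(** The default of [head] makes a unit clause [a] behave as [a \/ a]. An empty clause has no edges;
    it is reported through [rBad] instead. *)
Definition clause_edges (c : seq nat) : seq (nat * nat) :=
  if c is a :: c' then [:: (neg a, head a c'); (neg (head a c'), a)] else [::].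

Definition formula_edges (phi : seq (seq nat)) : seq (nat * nat) :=
  flatten [seq clause_edges c | c <- phi].

Definition code_formula (phi : seq (seq nat)) : seq nat :=
  size phi :: flatten [seq size c :: c | c <- phi].

Definition wf_formula (n : nat) (phi : seq (seq nat)) : bool :=
  all (fun c => (size c <= 2) && all (fun z => z < n.*2) c) phi.

Definition add_edge (x y : nat) : cmd :=
  Add rE rE rOne ;; Write aTgt rE y ;; Read rX aHead x ;;
  Write aNext rE rX ;; Write aHead x rE.

Definition read_clause : cmd :=
  Read rZ aIn rPos ;; Add rPos rPos rOne ;;
  If rZ
    (Read rL aIn rPos ;; Add rPos rPos rOne ;; Read rNL aNeg rL ;;
     Defs.Sub rZ rZ rOne ;; Add rY rL rZero ;;
     If rZ (Read rY aIn rPos ;; Add rPos rPos rOne) Skip ;;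
     Read rNZ aNeg rY ;;
     add_edge rNL rY ;; add_edge rNZ rL)
    (Const rBad 1) ;;
  Defs.Sub rCount rCount rOne.

Definition read_formula : cmd :=
  Read rCount aIn rPos ;; Add rPos rPos rOne ;; While rCount read_clause.

(** With only addition and truncated subtraction at hand, the bit flip [neg] is tabulated, one
    variable per iteration. *)
Definition fill_neg : cmd :=
  While rCount
    (Add rY rX rOne ;; Write aNeg rX rY ;; Write aNeg rY rX ;; Add rX rY rOne ;;
     Defs.Sub rCount rCount rOne).

Definition read_stages (each : bool) : cmd :=
  While rStages
    (read_formula ;; (if each then solve else Skip) ;;
     Defs.Sub rStages rStages rOne).

(* With [each], the stages are solved separately; otherwise their conjunction
   is. *)
Definition multistage_program (each : bool) : cmd :=
  Const rOne 1 ;; Read rCount aIn rZero ;; Add rPos rCount rOne ;; fill_neg ;;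
  Read rStages aIn rPos ;; Add rPos rPos rOne ;; Add rPos rPos rOne ;;
  read_stages each ;; solve ;; Defs.Sub rRes rOne rBad.

Lemma drop_consP (w : seq nat) p x r :
  drop p w = x :: r -> [/\ nth 0 w p = x, drop p.+1 w = r & p < size w].
Proof.
move=> e; split.
- by rewrite -[p]addn0 -nth_drop e.
- by rewrite -add1n -drop_drop e /= drop0.
- by rewrite ltnNge; apply/negP => /drop_oversize; rewrite e.
Qed.

(** * Building the implication graph from the encoded stages *)

Section Build.
Variables (W n : nat) (w : seq nat).
Hypothesis W_ge : 8 * size w + 2 * n + 10 <= W.

Lemma add_edge_ok x y E e0 s : x \notin [:: rE; rX] -> y \notin [:: rE; rX] ->
  size E < W -> graph_state E e0 n s ->
  wp W (add_edge x y) s (fun t s' => t <= 5 /\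
    graph_state (rcons E (reg s x, reg s y)) e0 n s').
Proof.
rewrite !inE !negb_or => /andP[/negbTE x5 /negbTE x13] /andP[/negbTE y5 _] lt.
case=> one zero se se0 sneg shead snext stgt; rewrite /add_edge.
do 9 exec1; rewrite ?x5 ?x13 ?y5 ?one ?se ?addn1 //.
have lastE k v : k <= size E -> last_out (rcons E (reg s x, reg s y)) v k = last_out E v k.
  by move=> h; rewrite -cats1 last_out_cat.
have srcE : src (rcons E (reg s x, reg s y)) (size E).+1 = reg s x.
  by rewrite /src /= nth_rcons ltnn eqxx.
have tgtE : tgt (rcons E (reg s x, reg s y)) (size E).+1 = reg s y.
  by rewrite /tgt /= nth_rcons ltnn eqxx.
split=> //; split; rewrite /= ?size_rcons //.
- by move=> v /=; rewrite srcE lastE // shead eq_sym.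
- move=> j /andP[j1]; rewrite leq_eqVlt => /orP[/eqP ->|j2].
    by rewrite eqxx srcE lastE // shead.
  rewrite ltn_eqF // snext ?j1 // -cats1 src_cat ?j1 // last_out_cat //; lia.
- move=> j /andP[j1]; rewrite leq_eqVlt => /orP[/eqP ->|j2].
    by rewrite eqxx tgtE.
  by rewrite ltn_eqF // stgt ?j1 // -cats1 tgt_cat ?j1.
Qed.

Definition input_state (s : state) : Prop := forall i, arr s aIn i = nth 0 w i.

Lemma read_clause_ok c rest E e0 s : graph_state E e0 n s -> input_state s ->
  drop (reg s rPos) w = size c :: c ++ rest -> size c <= 2 ->
  all (fun z => z < n.*2) c -> size E + 2 <= W ->
  wp W read_clause s (fun t s' => [/\ t <= 40,
    graph_state (E ++ clause_edges c) e0 n s', drop (reg s' rPos) w = rest,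
    reg s' rCount = reg s rCount - 1 &
    (reg s' rBad == 0) = ~~ nilp c && (reg s rBad == 0)]).
Proof.
move=> gs win dr c2 cn EW; have [one zero se se0 sneg shead snext stgt] := gs.
have [w0 {}dr lt] := drop_consP dr.
rewrite /read_clause; do 4 exec1; rewrite one addn1 win w0.
exec1; apply: wp_If => /= c0; last first.
  case: c c0 dr c2 cn {w0} => //= _ dr _ _.
  by do 2 exec1; rewrite one cats0; split=> //.
case: c c0 dr c2 cn {w0} => //= a c _ dr c2 /andP[an cn].
have [w1 {}dr lt1] := drop_consP dr.
do 10 exec1; rewrite ?one ?win ?w1 ?addn1 ?zero ?addn0 //; try lia.
set s1 := set_reg _ _ _.
have gs1 : graph_state E e0 n s1 by split.
exec1.
(* Both branches are merged: [rY] holds the second literal, or a copy of the first one in a unit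
   clause. *)
apply: (@wp_weaken _ _ _ (fun t s' => [/\ t <= 4, reg s' rY = head a c,
  drop (reg s' rPos) w = rest, graph_state E e0 n s' & reg s' rY < n.*2])).
  apply: wp_If => /=; rewrite subn1 /= => sz.
    have [b Ec] : exists b, c = [:: b] by case: (c) c2 sz => // b [] // _ _; exists b.
    move: cn dr; rewrite Ec /= => /andP[bn _] dr.
    have [w2 {}dr lt2] := drop_consP dr.
    by do 3 exec1; rewrite ?one ?win ?w2 ?addn1 //; try lia; split=> //; case: gs1 => *; split.
  have Ec : c = [::] by apply/eqP; rewrite -size_eq0 sz.
  by move: dr; rewrite Ec => dr; apply: wp_Skip; split.
move=> t2 s2 [lt2 y2 dr2 gs2 yn] fr2.
have L2 : reg s2 rL = a by rewrite (frame_reg fr2).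
have NL2 : reg s2 rNL = neg a by rewrite (frame_reg fr2) //= sneg.
have cnt2 : reg s2 rCount = reg s rCount by rewrite (frame_reg fr2).
have bad2 : reg s2 rBad = reg s rBad by rewrite (frame_reg fr2).
do 2 exec1; rewrite (gs_neg gs2 yn) y2.
set s3 := set_reg _ _ _.
have gs3 : graph_state E e0 n s3 by case: gs2 => *; split.
exec1; apply: wp_weaken (@add_edge_ok rNL rY _ _ _ isT isT _ gs3) _; first by lia.
move=> t4 s4 [lt4 gs4] fr4.
apply: wp_weaken (@add_edge_ok rNZ rL _ _ _ isT isT _ gs4) _; first by rewrite size_rcons; lia.
move=> t5 s5 [lt5 gs5] fr5.
exec1; rewrite (gs_one gs5).
split=> /=.
- by lia.
- move: gs5; rewrite !(frame_reg fr4) //= y2 L2 NL2 -!cats1 -catA /= => gs5.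
  by case: gs5 => *; split.
- by rewrite (frame_reg fr5) // (frame_reg fr4).
- by rewrite (frame_reg fr5) // (frame_reg fr4) //= cnt2.
- by rewrite (frame_reg fr5) // (frame_reg fr4) //= bad2.
Qed.

Lemma read_clauses_ok phi rest E e0 s : graph_state E e0 n s -> input_state s ->
  drop (reg s rPos) w = flatten [seq size c :: c | c <- phi] ++ rest ->
  wf_formula n phi -> size E + 2 * size phi <= W -> reg s rCount = size phi ->
  wp W (While rCount read_clause) s (fun t s' => [/\ t <= 50 * size phi + 1,
    graph_state (E ++ formula_edges phi) e0 n s', drop (reg s' rPos) w = rest &
    (reg s' rBad == 0) = ~~ has (@nilp nat) phi && (reg s rBad == 0)]).
Proof.
elim: phi E s => [|c phi IH] E s gs win dr.
  by move=> _ _ cnt; apply: wp_While_stop => //; split; rewrite ?cats0.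
rewrite [wf_formula _ _]/= => /andP[/andP[c2 cn] wf] EW cnt.
apply: wp_While_step; first by rewrite cnt.
move: dr; rewrite /= -catA => dr.
apply: wp_weaken (read_clause_ok gs win dr c2 cn _) _; first by move: EW => /=; lia.
move=> t1 s1 [t1le gs1 dr1 cnt1 bad1] fr1.
have win1 : input_state s1 by move=> i; rewrite (frame_arr fr1).
have sz : size (clause_edges c) <= 2 by case: (c).
apply: wp_weaken (IH _ _ gs1 win1 dr1 wf _ _) _.
- by rewrite size_cat; move: EW sz => /=; lia.
- by rewrite cnt1 cnt /=; lia.
move=> t2 s2 [t2le gs2 dr2 bad2] _; split=> //.
- by lia.
- by rewrite /formula_edges /= catA.
- by rewrite bad2 bad1 negb_or andbA [~~ nilp c && _]andbC.
Qed.

Lemma read_formula_ok phi rest E e0 s : graph_state E e0 n s -> input_state s ->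
  drop (reg s rPos) w = code_formula phi ++ rest ->
  wf_formula n phi -> size E + 2 * size phi <= W ->
  wp W read_formula s (fun t s' => [/\ t <= 50 * size phi + 3,
    graph_state (E ++ formula_edges phi) e0 n s', drop (reg s' rPos) w = rest &
    (reg s' rBad == 0) = ~~ has (@nilp nat) phi && (reg s rBad == 0)]).
Proof.
move=> gs win dr wf EW; have [w0 {}dr lt] := drop_consP dr.
rewrite /read_formula; do 4 exec1; rewrite (gs_one gs) ?addn1 ?win ?w0; first by lia.
set s1 := set_reg _ _ _.
have gs1 : graph_state E e0 n s1 by case: gs => *; split.
apply: wp_weaken (read_clauses_ok gs1 win dr wf EW erefl) _.
by move=> t s' [tle gs' dr' bad'] _; split=> //; lia.
Qed.

Definition regular (B : seq (nat * nat)) : Prop :=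
  skew B /\ forall ab, ab \in B -> ab.1 < n.*2 /\ ab.2 < n.*2.

Lemma regular_nil : regular [::].
Proof. by split. Qed.

Lemma regular_cat B B' : regular B -> regular B' -> regular (B ++ B').
Proof.
move=> [sk lt] [sk' lt']; split=> [a b|ab]; rewrite !mem_cat => /orP[].
- by move/sk => ->.
- by move/sk' => ->; rewrite orbT.
- exact: lt.
- exact: lt'.
Qed.

Lemma regular_formula phi : wf_formula n phi -> regular (formula_edges phi).
Proof.
elim: phi => [|c phi IH]; first by move=> _; apply: regular_nil.
rewrite [wf_formula _ _]/= => /andP[/andP[c2 cn] wf].
apply: regular_cat (IH wf).
case: c c2 cn => [|a c' _ /= /andP[an c'n]]; first by move=> *; apply: regular_nil.
have bn : head a c' < n.*2 by case: c' c'n => //= b c' /andP[].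
split=> [x y|ab]; rewrite !inE.
  by move=> /orP[]/eqP[-> ->]; rewrite !negK eqxx ?orbT.
by move=> /orP[]/eqP -> /=; rewrite neg_lt.
Qed.

(** The situation before a call of the solver: the edges above [e0] are the pending batch, and
    [rPh0 = rPh] makes the decision table count as empty. There has been at most one phase per
    solved edge, whence [rdy_ph]. *)
Record ready (E : seq (nat * nat)) (e0 : nat) (s : state) : Prop := Ready {
  rdy_graph : graph_state E e0 n s;
  rdy_stamped : stamped s;
  rdy_ph0 : reg s rPh0 = reg s rPh;
  rdy_ph : reg s rPh <= e0;
  rdy_e0 : e0 <= size E;
  rdy_regular : regular (drop e0 E) }.

Lemma regular_lits E e0 : regular (drop e0 E) ->
  forall z, z \in lits E e0 -> z < n.*2.
Proof.
move=> [_ lt] z; rewrite mem_cat => /orP[] /mapP[ab /lt [l1 l2] -> //].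
Qed.

Lemma solve_ready E e0 s : ready E e0 s -> 4 * size E + 10 <= W ->
  wp W solve s (fun t s' => [/\ t <= 900 * (size E - e0) + 10, ready E (size E) s' &
    reg s' rBad = 0 <-> (exists f, models (drop e0 E) f) /\ reg s rBad = 0]).
Proof.
move=> [gs st eph phe e0E reg0] EW; have lt := regular_lits reg0.
apply: wp_weaken (solve_ok EW reg0.1 e0E lt gs st eph phe) _.
move=> t s' [tle st' [eph' phe'] e0' out] fr; split=> //; last first.
  by case: out => -[sat bad]; rewrite bad; split=> [|[]].
split=> //; last by rewrite drop_size; apply: regular_nil.
case: gs => one zero se se0 sneg shead snext stgt.
split=> [|||//|v|v|j|j]; rewrite ?(frame_reg fr) ?(frame_arr fr) //; auto.
Qed.

Definition code_formulas (phis : seq (seq (seq nat))) : seq nat :=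
  flatten [seq code_formula phi | phi <- phis].

Definition formulas_edges (phis : seq (seq (seq nat))) : seq (nat * nat) :=
  flatten [seq formula_edges phi | phi <- phis].

Definition edges_sat (B : seq (nat * nat)) : Prop := exists f, models B f.

Lemma size_formula_edges phi : size (formula_edges phi) <= 2 * size phi.
Proof.
elim: phi => // c phi IH; rewrite /formula_edges /= size_cat -/(formula_edges phi).
have : size (clause_edges c) <= 2 by case: (c).
lia.
Qed.

Lemma size_code_formula phi : size phi < size (code_formula phi).
Proof. by rewrite /= ltnS; elim: phi => //= c phi IH; rewrite size_cat; lia. Qed.

(** With [each], the batch is empty whenever a stage begins, so the stage is solved alone; otherwise
    [e0] stays fixed and the batch accumulates the conjunction. Since a clause gives at most two
    edges, solving a stage costs at most 1800 per clause, within the factor 2000. *)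
Lemma read_stages_ok (each : bool) phis E e0 s : ready E e0 s -> input_state s ->
  drop (reg s rPos) w = code_formulas phis ->
  all (wf_formula n) phis -> size E + 2 * size (code_formulas phis) <= 2 * size w ->
  reg s rStages = size phis -> (each -> e0 = size E) ->
  wp W (read_stages each) s (fun t s' => exists E' e0',
    [/\ t <= 2000 * size (code_formulas phis) + 1, ready E' e0' s',
        size E' <= size E + 2 * size (code_formulas phis),
        if each then e0' = size E' else e0' = e0 /\ E' = E ++ formulas_edges phis &
        reg s' rBad = 0 <-> reg s rBad = 0 /\
          forall phi, phi \in phis -> ~~ has (@nilp nat) phi /\
             (each -> edges_sat (formula_edges phi))]).
Proof.
elim: phis E e0 s => [|phi phis IH] E e0 s rdy win dr wf EW cnt eE.
  apply: wp_While_stop => //; exists E, e0; split=> //.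
  - by rewrite addn0.
  - by case: ifP eE => [_ -> //|_ _]; rewrite cats0.
  - by split=> [|[]].
case/andP: wf => wf wfs.
have cE : code_formulas (phi :: phis) = code_formula phi ++ code_formulas phis by [].
rewrite cE in dr EW *; rewrite size_cat in EW *.
have szphi := size_code_formula phi; have szE := size_formula_edges phi.
move: szphi EW; move: (size (code_formula phi)) => sz szphi EW.
apply: wp_While_step; first by rewrite cnt.
exec1; apply: wp_weaken (read_formula_ok (rdy_graph rdy) win dr wf _) _; first by lia.
move=> t1 s1 [t1le gs1 dr1 bad1] fr1.
have rdy1 : ready (E ++ formula_edges phi) e0 s1.
  case: rdy => gs [V M ph0le] eph phe e0E regE; split=> //.
  - split=> [z|b z|]; rewrite !(frame_reg fr1) ?(frame_arr fr1) //; by case: (b).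
  - by rewrite !(frame_reg fr1).
  - by rewrite !(frame_reg fr1).
  - by rewrite size_cat; lia.
  - rewrite drop_cat; case: ltnP => h; first exact: regular_cat (regular_formula wf).
    have -> : e0 - size E = 0 by lia.
    by rewrite drop0; apply: regular_formula.
have win1 : input_state s1 by move=> i; rewrite (frame_arr fr1).
have cnt1 : reg s1 rStages = (size phis).+1 by rewrite (frame_reg fr1).
(* A common postcondition for both variants: the batch start [e1] moves to the end of the edges if
   the stage was solved and stays put otherwise. *)
exec1; apply: (@wp_weaken _ _ _ (fun t s' => exists e1,
  [/\ t <= 900 * (2 * size phi) + 10, ready (E ++ formula_edges phi) e1 s',
      if each then e1 = size (E ++ formula_edges phi) else e1 = e0,
      reg s' rBad = 0 <-> reg s1 rBad = 0 /\ (each -> edges_sat (formula_edges phi)) &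
      [/\ reg s' rPos = reg s1 rPos, reg s' rStages = reg s1 rStages & input_state s']])).
  case: each eE {IH} => eE; last first.
    apply: wp_Skip; exists e0; split=> //; first by lia.
    by split=> [|[]].
  apply: wp_weaken (solve_ready rdy1 _) _; first by rewrite size_cat; lia.
  move=> t s' [tle rdy' bad'] fr; exists (size (E ++ formula_edges phi)); split=> //.
  - by move: tle; rewrite size_cat (eE isT); lia.
  - rewrite bad' eE // drop_size_cat //.
    by split=> [[sat b0]|[b0 sat]]; split=> //; apply: sat.
  - by rewrite !(frame_reg fr); split=> // i; rewrite (frame_arr fr).
move=> t2 s2 [e1 [t2le rdy2 e1E bad2 [pos2 cnt2 win2]]] _.
exec1; rewrite cnt2 cnt1 (gs_one (rdy_graph rdy2)).
set s3 := set_reg _ _ _.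
have rdy3 : ready (E ++ formula_edges phi) e1 s3.
  by case: rdy2 => -[*] *; split=> //; split.
have pos3 : drop (reg s3 rPos) w = code_formulas phis by rewrite -dr1 -pos2.
apply: wp_weaken (IH _ _ _ rdy3 win2 pos3 wfs _ _ _) _.
- by rewrite size_cat; lia.
- by rewrite /= subn1.
- by move: e1E; case: (each).
move=> t4 s4 [E' [e0' [t4le rdy4 szE' vE bad4]]] _.
exists E', e0'; split=> //.
- by lia.
- by move: szE'; rewrite size_cat; lia.
- move: vE e1E; case: (each) => // -[-> ->] ->.
  by rewrite -catA.
- rewrite bad4 bad2; split.
    move=> [[/eqP b1 sat] h]; move: b1; rewrite bad1 => /andP[nn /eqP b0].
    split=> // psi; rewrite inE => /orP[/eqP ->|/h //].
    by split.
  move=> [/eqP b0 h]; have [nn sat] := h phi (mem_head _ _).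
  split; first by split=> //; apply/eqP; rewrite bad1 nn.
  by move=> psi hpsi; apply: h; rewrite inE hpsi orbT.
Qed.

Lemma fill_neg_ok i s : reg s rOne = 1 -> reg s rX = i.*2 -> i + reg s rCount = n ->
  (forall v, v < i.*2 -> arr s aNeg v = neg v) ->
  wp W fill_neg s (fun t s' => t <= 10 * reg s rCount + 1 /\
    forall v, v < n.*2 -> arr s' aNeg v = neg v).
Proof.
move em: (reg s rCount) => m; elim: m i s em => [|m IH] i s em one x0 im tab.
  by apply: wp_While_stop => //; split=> // v; rewrite -im addn0; apply: tab.
apply: wp_While_step; first by rewrite em.
do 9 exec1; rewrite ?one ?x0 ?addn1 ?em ?subn1 /=; try lia.
set s1 := set_arr _ _ _ _.
apply: wp_weaken (IH i.+1 _ _ _ _ _ _) _ => //=; first by lia.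
- move=> v; rewrite doubleS => lt.
  case: eqP => [->|/eqP n1]; first by rewrite /neg /= odd_double.
  case: eqP => [->|/eqP n2]; first by rewrite /neg odd_double.
  by apply: tab; lia.
- by move=> t s' [tle tab'] _; split=> //; lia.
Qed.

Lemma multistage_program_ok (each : bool) phis d :
  w = (n :: iota 0 n) ++ [:: size phis; d] ++ code_formulas phis ->
  all (wf_formula n) phis ->
  wp W (multistage_program each) (init_state w) (fun t s' => t <= 4000 * size w /\
    (reg s' rRes != 0 <-> (forall phi, phi \in phis -> ~~ has (@nilp nat) phi) /\
      if each then forall phi, phi \in phis -> edges_sat (formula_edges phi)
      else edges_sat (formulas_edges phis))).
Proof.
move=> wE wf.
have szw : size w = n + size (code_formulas phis) + 3.
  by rewrite wE /= size_cat size_iota /=; lia.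
have w0 : nth 0 w 0 = n by rewrite wE.
have dr : drop n.+1 w = size phis :: d :: code_formulas phis.
  by rewrite wE /= drop_cat size_iota ltnn subnn.
have [w1 {}dr _] := drop_consP dr; have [_ {}dr _] := drop_consP dr.
rewrite /multistage_program; do 6 exec1; rewrite w0.
set s1 := set_reg _ _ _.
exec1; apply: wp_weaken (@fill_neg_ok 0 s1 erefl erefl erefl _) _ => // t2 s2 [t2le tab] fr2.
have one2 : reg s2 rOne = 1 by rewrite (frame_reg fr2).
have pos2 : reg s2 rPos = n.+1 by rewrite (frame_reg fr2) //= addn1.
have win2 i : arr s2 aIn i = nth 0 w i by rewrite (frame_arr fr2).
do 6 exec1; rewrite win2 pos2 one2 w1 !addn1.
set s3 := set_reg _ _ _.
have gs3 : graph_state [::] 0 n s3.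
  split=> //=; rewrite ?(frame_reg fr2) //.
  - by move=> v; rewrite (frame_arr fr2).
  - by case.
  - by case.
have rdy3 : ready [::] 0 s3.
  split=> //=; rewrite ?(frame_reg fr2) //.
  by split=> [z|[] z|] /=; rewrite ?(frame_arr fr2) ?(frame_reg fr2).
have win3 : input_state s3 by move=> i; rewrite /= (frame_arr fr2).
exec1; apply: wp_weaken (@read_stages_ok each phis _ _ _ rdy3 win3 dr wf _ erefl _) _ => //.
  by rewrite /=; lia.
move=> t4 s4 [E [e0 [t4le rdy4 szE vE bad4]]] _.
exec1; apply: wp_weaken (solve_ready rdy4 _) _; first by move: szE => /=; lia.
move=> t5 s5 [t5le rdy5 bad5] _.
exec1; rewrite (gs_one (rdy_graph rdy5)); split.
  (* Reading contributes 2000 per word of the stages, the final call of [solve] 1800 (at most two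
     edges per word), and the negation table 10 per variable. *)
  move: t2le szE; rewrite /=; lia.
have -> : 1 - reg s5 rBad != 0 <-> reg s5 rBad = 0 by split; lia.
rewrite bad5 bad4 /= (frame_reg fr2) //=.
case: each vE {bad4} => [->|[-> ->]].
  rewrite drop_size; split=> [[_ [_ h]]|[h1 h2]].
    by split=> phi /h [] // _; apply.
  (* The final call of [solve] sees an empty batch here, so any valuation respecting negation is a
     model. *)
  split; first by exists odd; split=> // v; apply: odd_neg.
  by split=> // phi hp; split; [apply: h1 | move=> _; apply: h2].
rewrite drop0 cat0s; split=> [[sat [_ h]]|[h sat]]; first by split=> // phi /h [].
by split=> //; split=> // phi /h.
Qed.

End Build.

(** * From clauses to implications *)

Section Semantics.
Variable n : nat.
Implicit Types (C : clause n) (phi : cnf2 n) (g : assignment n).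

Definition code_clause C : seq nat := [seq enc_literal l | l <- C].

Definition assignment_of (f : nat -> bool) : assignment n := [ffun i : 'I_n => f (i.*2.+1)].

(** Codes outside the range default to their parity, since [models] demands that negation be
    respected at every number. *)
Definition literal_values g (v : nat) : bool :=
  if insub v./2 is Some i then g i == odd v else odd v.

Lemma half_neg v : (neg v)./2 = v./2.
Proof. by rewrite /neg; case: ifP; lia. Qed.

Lemma literal_values_neg g v : literal_values g (neg v) = ~~ literal_values g v.
Proof.
rewrite /literal_values half_neg odd_neg; case: insub => // i.
by case: (g i); case: odd.
Qed.

Lemma literal_values_enc g (l : literal n) : literal_values g (enc_literal l) = sat_literal g l.
Proof.
case: l => i b; rewrite /literal_values /enc_literal /sat_literal /=.
have -> : (i.*2 + b)./2 = i by case: b => /=; lia.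
by rewrite valK oddD odd_double; case: b.
Qed.

Lemma assignment_of_enc f (l : literal n) : (forall v, f (neg v) = ~~ f v) ->
  sat_literal (assignment_of f) l = f (enc_literal l).
Proof.
case: l => i b fn; rewrite /sat_literal /enc_literal ffunE /=.
case: b; first by rewrite addn1 eqb_id.
by rewrite addn0 eqbF_neg -fn /neg /= odd_double.
Qed.

(** Both edges of a unit clause [a] lead from [neg a] to [a], which holds exactly when [a] is true.
    The empty clause satisfies the edge condition vacuously, hence the conjunct [~~ nilp c]. *)
Lemma clause_edgesP f c : (forall v, f (neg v) = ~~ f v) -> size c <= 2 ->
  has f c <-> ~~ nilp c /\ forall ab, ab \in clause_edges c -> f ab.1 -> f ab.2.
Proof.
move=> fn; case: c => [|a [|b [|]]] //= _; first by split=> // -[].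
  rewrite orbF; split=> [fa|[_ /(_ _ (mem_head _ _))] /=].
    by split=> // ab; rewrite !inE orbb => /eqP ->.
  by rewrite fn; case: (f a) => // /(_ isT).
rewrite orbF; split=> [fab|[_ /(_ _ (mem_head _ _))] /=].
  split=> // ab; rewrite !inE => /orP[]/eqP -> /=; rewrite fn => nf.
    by move: fab; rewrite (negbTE nf).
  by move: fab; rewrite (negbTE nf) orbF.
by rewrite fn; case: (f a) => //= /(_ isT).
Qed.

Definition code_cnf2 phi : seq (seq nat) := [seq code_clause C | C <- phi].

Lemma sat_formulas (phis : seq (cnf2 n)) :
  (exists g, all (satisfies g) phis) <->
  (forall psi, psi \in map code_cnf2 phis -> ~~ has (@nilp nat) psi) /\
  edges_sat (formulas_edges (map code_cnf2 phis)).
Proof.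
have clauseP f C : (forall v, f (neg v) = ~~ f v) -> has f (code_clause C) <->
    ~~ nilp (code_clause C) /\ forall ab, ab \in clause_edges (code_clause C) -> f ab.1 -> f ab.2.
  by move=> fn; apply: clause_edgesP; rewrite // size_map size_bseq.
split=> [[g /allP sat]|[nn [f [fn mf]]]].
  have fn := literal_values_neg g.
  have cl phi C : phi \in phis -> C \in phi -> has (literal_values g) (code_clause C).
    move=> hp hC; have /allP/(_ C hC) := sat phi hp.
    by rewrite /code_clause has_map; apply: sub_has => l /=; rewrite literal_values_enc.
  split.
    move=> _ /mapP[phi hp ->]; apply/hasPn => _ /mapP[C hC ->].
    by have /(clauseP _ _ fn)[] := cl _ _ hp hC.
  exists (literal_values g); split=> // ab /flattenP[_ /mapP[_ /mapP[phi hp ->] ->]].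
  move=> /flattenP[_ /mapP[_ /mapP[C hC ->] ->]].
  by have /(clauseP _ _ fn)[_] := cl _ _ hp hC; apply.
exists (assignment_of f); apply/allP => phi hp; apply/allP => C hC.
have : has f (code_clause C).
  apply/(clauseP _ _ fn); split.
    have /hasPn := nn _ (map_f code_cnf2 hp); apply; exact: map_f.
  move=> ab hab; apply: mf; apply/flattenP.
  exists (formula_edges (code_cnf2 phi)); first by apply: map_f; apply: map_f.
  apply/flattenP; exists (clause_edges (code_clause C)) => //.
  by apply: map_f; apply: map_f.
by rewrite /code_clause has_map; apply: sub_has => l /=; rewrite assignment_of_enc.
Qed.

Lemma wf_code_cnf2 phi : wf_formula n (code_cnf2 phi).
Proof.
apply/allP => _ /mapP[C _ ->]; rewrite size_map size_bseq /=.
apply/allP => _ /mapP[[i b] _ ->]; rewrite /enc_literal /=.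
by have := ltn_ord i; case: b; lia.
Qed.

Lemma enc_cnf2E phi : enc_cnf2 phi = code_formula (code_cnf2 phi).
Proof.
rewrite /enc_cnf2 /code_formula size_map -map_comp; congr (_ :: flatten _).
by apply: eq_map => C /=; rewrite /enc_clause size_map.
Qed.

End Semantics.

(** * The special cases of Multistage 2-SAT *)

Section Instance.
Variable I : instance.

(** Consecutive assignments coincide, vacuously for one stage and because nothing may change for
    distance 0; so a solution is constant. *)
Lemma multistage_2sat_conj : nstages I = 1 \/ dist I = 0 ->
  multistage_2sat I <-> exists g, all (satisfies g) (stages I).
Proof.
move=> hI; split=> [[f [sat close]]|[g /all_tnthP sat]]; last first.
  exists (fun=> g); split=> [i|i j _]; first exact: sat.
  by rewrite (_ : [set x | _] = set0) ?cards0 //; apply/setP => x; rewrite !inE eqxx.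
have step (i j : 'I_(nstages I)) : j = i.+1 :> nat -> f i = f j.
  case: hI => [t1|d0] ij.
    by have := ltn_ord j; rewrite ij => h; exfalso; lia.
  have := close i j ij; rewrite d0 leqn0 cards_eq0 => /eqP/setP e.
  by apply/ffunP => x; have := e x; rewrite !inE => /negbFE/eqP.
pose i0 := Ordinal (nstages_gt0 I).
have all_eq m (hm : m < nstages I) : f (Ordinal hm) = f i0.
  elim: m hm => [|m IH] hm; first by congr f; apply: val_inj.
  by rewrite -(IH (ltnW hm)); apply/esym; apply: step.
exists (f i0); apply/all_tnthP => -[m hm].
by rewrite -(all_eq m hm).
Qed.

(** No two assignments differ in more than [nvars I] variables, so the stages can be solved
    separately. *)
Lemma multistage_2sat_indep : dist I = nvars I ->
  multistage_2sat I <-> forall phi, phi \in tval (stages I) -> exists g, satisfies g phi.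
Proof.
move=> dn; split=> [[f [sat _]] phi /tnthP[i ->]|sat]; first by exists (f i).
have ex i : exists g, satisfies g (tnth (stages I) i) by apply: sat; apply: mem_tnth.
exists (fun i => xchoose (ex i)); split=> [i|i j _]; first exact: (xchooseP (ex i)).
by rewrite dn -[nvars I in X in _ <= X]card_ord max_card.
Qed.

Lemma enc_instanceE : enc_instance I = (nvars I :: iota 0 (nvars I)) ++
  [:: size [seq code_cnf2 phi | phi <- stages I]; dist I] ++
  code_formulas [seq code_cnf2 phi | phi <- stages I].
Proof.
rewrite /enc_instance size_map size_tuple /code_formulas -map_comp.
by congr (_ ++ (_ ++ flatten _)); apply: eq_map => phi; apply: enc_cnf2E.
Qed.

Lemma multistage_program_run (each : bool) :
  let w := enc_instance I in
  exists t s, [/\ exec (4000 * (size w + \max_(k <- w) k)) (multistage_program each) (init_state w) t s,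
    t <= 4000 * size w &
    reg s 0 != 0 <-> if each then forall phi, phi \in tval (stages I) -> exists g, satisfies g phi
                     else exists g, all (satisfies g) (stages I)].
Proof.
move=> w; set W := 4000 * _.
(* The variables are listed in the encoding, so the length alone dominates [nvars I] in the word
   bound. *)
have szw : nvars I + 3 <= size w.
  by rewrite /w enc_instanceE /= size_cat size_iota /=; lia.
have W_ge : 8 * size w + 2 * nvars I + 10 <= W.
  by rewrite /W; move: (\max_(k <- w) k) => M; lia.
have wf : all (wf_formula (nvars I)) [seq code_cnf2 phi | phi <- stages I].
  by apply/allP => _ /mapP[phi _ ->]; apply: wf_code_cnf2.
have [t [s [ex [tle res]]]] := multistage_program_ok W_ge each enc_instanceE wf.
exists t, s; split=> //; rewrite res; case: each {ex res} => /=; last by rewrite sat_formulas.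
(* A single stage is the conjunction of a one-element list. *)
have one phi : (exists g, satisfies g phi) <->
    ~~ has (@nilp nat) (code_cnf2 phi) /\ edges_sat (formula_edges (code_cnf2 phi)).
  have := sat_formulas [:: phi]; rewrite /formulas_edges /= cats0 => h; split.
    move=> [g sat]; have [|nn es] := h.1; first by exists g; rewrite /= sat.
    by split=> //; apply: nn; apply: mem_head.
  move=> [nn es]; have [|g] := h.2; last by rewrite /= andbT; exists g.
  by split=> // psi; rewrite inE => /eqP ->.
split=> [[nn es] phi hp|h].
  by apply/one; split; [apply: nn | apply: es]; apply: map_f.
by split=> _ /mapP[phi /h/one[nn es] ->].
Qed.

End Instance.

Theorem mainTheorem11 :
  [/\ linear_time_solvable enc_instance
        (fun I : instance => nstages I = 1) multistage_2sat,
      linear_time_solvable enc_instance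
        (fun I : instance => dist I = 0) multistage_2sat
    & linear_time_solvable enc_instance
        (fun I : instance => dist I = nvars I) multistage_2sat].
Proof.
split; [exists (multistage_program false) | exists (multistage_program false) |
        exists (multistage_program true)]; exists 4000 => I PI w;
  [have [t [s [ex tle res]]] := multistage_program_run I false |
   have [t [s [ex tle res]]] := multistage_program_run I false |
   have [t [s [ex tle res]]] := multistage_program_run I true];
  exists t, s; split=> //; rewrite res.
- by rewrite multistage_2sat_conj //; left.
- by rewrite multistage_2sat_conj //; right.
- by rewrite multistage_2sat_indep.
Qed.
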